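(* (a) Let $t: D(t)\subseteq E\rightarrow E$ be a regular Fredholm operator on a Hilbert $C^*$-module $E$. Then there exists $\varepsilon>0$ with the following properties: (i) $D+t$ is a regular Fredholm operator for every selfadjoint bounded adjointable operator $D$ on $E$ satisfying $\|D\|\le\varepsilon$. (ii) Suppose in addition that $t$ is selfadjoint. If $s: D(s)\subseteq E\rightarrow E$ is a selfadjoint regular operator on $E$ such that $D(t)\subseteq D(s)$ and $$\|s(x)\|\le \varepsilon\big(\|(t+s)(x)\|+\|x\|\big)\quad\text{for all } x\in D(t),$$ then $t+s$ (with domain $D(t)$) is a selfadjoint regular Fredholm operator. (iii) If $s$ is a regular operator on $E$ with $g(s,t)\le\varepsilon$, where $g$ is the gap metric, then $s$ is Fredholm. (b) Let $t$ and $s$ be selfadjoint regular operators on a countably generated Hilbert $C^*$-module $E$ over a unital $C^*$-algebra $A$. Suppose that $t$ is Fredholm and $s$ is $t$-compact. Then $s+t$ (with domain $D(t)$) is a selfadjoint regular Fredholm operator.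
   Context: For a Hilbert $C^*$-module $E$, $L(E)$ denotes the bounded adjointable operators on $E$ and $K(E)$ the compact operators on $E$ (the norm closure of the linear span of the operators $z\mapsto x\langle y,z\rangle$, $x,y\in E$); compact operators between two Hilbert $C^*$-modules over the same algebra are defined analogously. A closed densely defined operator $t:D(t)\subseteq E\to E$ with densely defined adjoint $t^*$ is called regular if $I+t^*t$ has dense range. A regular operator $t$ is selfadjoint if $t=t^*$. A regular operator $t$ is Fredholm if it has a pseudo left inverse and a pseudo right inverse. Here $G\in L(E)$ is a pseudo left inverse of $t$ if $Gt$ is closable, its closure $\overline{Gt}$ lies in $L(E)$, and $\overline{Gt}\equiv 1 \bmod K(E)$; and $G\in L(E)$ is a pseudo right inverse of $t$ if $tG$ is closable, $\overline{tG}\in L(E)$, and $\overline{tG}\equiv 1\bmod K(E)$. Gap metric: for a regular operator $t$ on $E$, the graph $G(t)=\{(x,t(x)):x\in D(t)\}$ is orthogonally complemented in $E\oplus E$; let $P_{G(t)}$ be the orthogonal projection onto it. For regular operators $t,s$ on $E$, $g(t,s)=\|P_{G(t)}-P_{G(s)}\|$. Relative compactness: for a regular operator $t$ on $E$, $E(t)$ denotes $D(t)$ regarded as a Hilbert $C^*$-module with inner product $\langle x,y\rangle_t=\langle x,y\rangle+\langle t(x),t(y)\rangle$. If $t,s$ are regular operators on $E$ with $D(t)\subseteq D(s)$, then $s$ is called $t$-compact if $s:E(t)\to E$ (the restriction of $s$ to $D(t)$) is a compact operator between Hilbert $C^*$-modules. *)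

(* Defs.v *)
From HB Require Import structures.
From mathcomp Require Import all_boot all_order all_algebra.
From mathcomp Require Import complex.
From mathcomp Require Import all_classical all_reals all_analysis.

Set Implicit Arguments.
Unset Strict Implicit.
Unset Printing Implicit Defensive.

Import Order.TTheory GRing.Theory Num.Theory.
Import numFieldNormedType.Exports.

Local Open Scope classical_set_scope.
Local Open Scope ring_scope.
Local Open Scope complex_scope.

(* MathComp rings are unital, so the multiplication of a possibly non-unital
   C*-algebra is carried by this mixin. *)
HB.mixin Record isCStarAlgebra (R : realType) A
    of CompleteNormedModule R[i] A := {
  cmul : A -> A -> A;
  cstar : A -> A;
  cmulA : forall a b c, cmul a (cmul b c) = cmul (cmul a b) c;
  cmulDl : forall a b c, cmul (a + b) c = cmul a c + cmul b c;
  cmulDr : forall a b c, cmul a (b + c) = cmul a b + cmul a c;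
  cmulZl : forall (k : R[i]) a b, cmul (k *: a) b = k *: cmul a b;
  cmulZr : forall (k : R[i]) a b, cmul a (k *: b) = k *: cmul a b;
  cstarK : forall a, cstar (cstar a) = a;
  cstarD : forall a b, cstar (a + b) = cstar a + cstar b;
  cstarZ : forall (k : R[i]) a, cstar (k *: a) = k^* *: cstar a;
  cstarM : forall a b, cstar (cmul a b) = cmul (cstar b) (cstar a);
  cnormM : forall a b, `|cmul a b| <= `|a| * `|b|;
  cnorm_star : forall a, `|cmul (cstar a) a| = `|a| ^+ 2
}.

#[short(type="cstarAlgType")]
HB.structure Definition CStarAlgebra (R : realType) :=
  {A of isCStarAlgebra R A & CompleteNormedModule R[i] A}.

Definition unital (R : realType) (A : cstarAlgType R) : Prop :=
  exists e : A, forall a : A, cmul e a = a /\ cmul a e = a.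

(* In a C*-algebra a finite sum of elements b^* b is again of the form b^* b,
   so this is the usual cone of positive elements. *)
Definition cpositive (R : realType) (A : cstarAlgType R) (a : A) : Prop :=
  exists bs : seq A, a = \sum_(b <- bs) cmul (cstar b) b.

Fact cpositiveD (R : realType) (A : cstarAlgType R) (a b : A) :
  cpositive a -> cpositive b -> cpositive (a + b).
Proof. by move=> [s ->] [s' ->]; exists (s ++ s'); rewrite big_cat. Qed.

(* Definiteness and completeness are not required at this level; they come with
   the norm of a Hilbert C*-module below. *)
HB.mixin Record isSemiInnerModule (R : realType) (A : cstarAlgType R) E
    of GRing.Lmodule R[i] E := {
  mact : E -> A -> E;
  inner : E -> E -> A;
  mactDl : forall x y a, mact (x + y) a = mact x a + mact y a;
  mactDr : forall x a b, mact x (a + b) = mact x a + mact x b;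
  mactM : forall x a b, mact x (cmul a b) = mact (mact x a) b;
  mactZl : forall (k : R[i]) x a, mact (k *: x) a = k *: mact x a;
  mactZr : forall (k : R[i]) x a, mact x (k *: a) = k *: mact x a;
  innerDr : forall x y z, inner x (y + z) = inner x y + inner x z;
  innerZr : forall (k : R[i]) x y, inner x (k *: y) = k *: inner x y;
  inner_mact : forall x y a, inner x (mact y a) = cmul (inner x y) a;
  inner_star : forall x y, cstar (inner x y) = inner y x;
  inner_ge0 : forall x, cpositive (inner x x)
}.

#[short(type="semiInnerModType")]
HB.structure Definition SemiInnerModule (R : realType) (A : cstarAlgType R) :=
  {E of isSemiInnerModule R A E & GRing.Lmodule R[i] E}.

Definition hnorm (R : realType) (A : cstarAlgType R) (E : semiInnerModType A)
  (x : E) : R := Num.sqrt (complex.Re `|inner x x|).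

HB.mixin Record isHilbertModule (R : realType) (A : cstarAlgType R) E
    of SemiInnerModule R A E & CompleteNormedModule R[i] E := {
  norm_hnorm : forall x : E, `|x| = (hnorm x)%:C
}.

#[short(type="hilbertModType")]
HB.structure Definition HilbertModule (R : realType) (A : cstarAlgType R) :=
  {E of isHilbertModule R A E & SemiInnerModule R A E
      & CompleteNormedModule R[i] E}.

(* The direct sum, with inner product <x, x'> + <y, y'>.  Its [hnorm] is the
   Hilbert module norm, which is equivalent but not equal to the maximum norm
   `|_| of [E * F]; the product topology is the same for both. *)
Section DirectSum.
Variables (R : realType) (A : cstarAlgType R) (E F : semiInnerModType A).

Definition dsum_mact (p : E * F) (a : A) : E * F := (mact p.1 a, mact p.2 a).

Definition dsum_inner (p q : E * F) : A := inner p.1 q.1 + inner p.2 q.2.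

Fact dsum_mactDl p q a : dsum_mact (p + q) a = dsum_mact p a + dsum_mact q a.
Proof. by rewrite /dsum_mact /= !mactDl. Qed.

Fact dsum_mactDr p a b : dsum_mact p (a + b) = dsum_mact p a + dsum_mact p b.
Proof. by rewrite /dsum_mact /= !mactDr. Qed.

Fact dsum_mactM p a b : dsum_mact p (cmul a b) = dsum_mact (dsum_mact p a) b.
Proof. by rewrite /dsum_mact /= !mactM. Qed.

Fact dsum_mactZl (k : R[i]) p a : dsum_mact (k *: p) a = k *: dsum_mact p a.
Proof. by rewrite /dsum_mact /= !mactZl. Qed.

Fact dsum_mactZr (k : R[i]) p a : dsum_mact p (k *: a) = k *: dsum_mact p a.
Proof. by rewrite /dsum_mact /= !mactZr. Qed.

Fact dsum_innerDr p q r : dsum_inner p (q + r) = dsum_inner p q + dsum_inner p r.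
Proof. by rewrite /dsum_inner /= !innerDr addrACA. Qed.

Fact dsum_innerZr (k : R[i]) p q : dsum_inner p (k *: q) = k *: dsum_inner p q.
Proof. by rewrite /dsum_inner /= !innerZr scalerDr. Qed.

Fact dsum_inner_mact p q a :
  dsum_inner p (dsum_mact q a) = cmul (dsum_inner p q) a.
Proof. by rewrite /dsum_inner /= !inner_mact cmulDl. Qed.

Fact dsum_inner_star p q : cstar (dsum_inner p q) = dsum_inner q p.
Proof. by rewrite /dsum_inner cstarD !inner_star. Qed.

Fact dsum_inner_ge0 p : cpositive (dsum_inner p p).
Proof. exact: cpositiveD (inner_ge0 _) (inner_ge0 _). Qed.

HB.instance Definition _ := @isSemiInnerModule.Build R A (E * F)%type
  dsum_mact dsum_inner dsum_mactDl dsum_mactDr dsum_mactM dsum_mactZl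
  dsum_mactZr dsum_innerDr dsum_innerZr dsum_inner_mact dsum_inner_star
  dsum_inner_ge0.

End DirectSum.

Definition submodule (R : realType) (A : cstarAlgType R)
  (E : semiInnerModType A) (S : set E) : Prop :=
  [/\ S 0, forall x y, S x -> S y -> S (x + y),
      forall (k : R[i]) x, S x -> S (k *: x)
    & forall (a : A) x, S x -> S (mact x a)].

Definition countably_generated (R : realType) (A : cstarAlgType R)
  (E : hilbertModType A) : Prop :=
  exists x : nat -> E, forall S : set E,
    submodule S -> closed S -> (forall n, S (x n)) -> S = setT.

(* The supremum is meaningful only if it is taken over a bounded set, as is the
   case for the bounded operators to which [opnorm] is applied. *)
Definition opnorm (R : realType) (A : cstarAlgType R)
  (E F : semiInnerModType A) (T : E -> F) : R :=
  sup [set hnorm (T x) | x in [set x | hnorm x <= 1]].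

(* A-linearity follows from adjointability on Hilbert modules, and so does
   boundedness; both are recorded for convenience. *)
Record adjOp (R : realType) (A : cstarAlgType R) (E F : semiInnerModType A) :=
  AdjOp {
    adjOp_fun :> E -> F;
    adjOpD : forall x y, adjOp_fun (x + y) = adjOp_fun x + adjOp_fun y;
    adjOpZ : forall (k : R[i]) x, adjOp_fun (k *: x) = k *: adjOp_fun x;
    adjOp_mact : forall (a : A) x, adjOp_fun (mact x a) = mact (adjOp_fun x) a;
    adjOp_bounded : exists M : R, forall x, hnorm (adjOp_fun x) <= M * hnorm x;
    adjOp_adjointable : exists T' : F -> E,
      forall x y, inner (adjOp_fun x) y = inner x (T' y)
  }.

(* Scalars of the linear span are absorbed in the left vectors p.1.  A norm
   limit of finite rank operators is automatically bounded and adjointable. *)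
Definition compact_op (R : realType) (A : cstarAlgType R)
  (E F : semiInnerModType A) (T : E -> F) : Prop :=
  forall e : R, 0 < e -> exists ps : seq (F * E), forall z : E,
    hnorm (T z - \sum_(p <- ps) mact p.1 (inner p.2 z)) <= e * hnorm z.

(* An A-linear operator defined on a submodule [dom]; the values of [app]
   outside [dom] are irrelevant, operators being compared through [graph]. *)
Record unbOp (R : realType) (A : cstarAlgType R) (E F : semiInnerModType A) :=
  UnbOp {
    dom : set E;
    app :> E -> F;
    dom_submodule : submodule dom;
    appD : forall x y, dom x -> dom y -> app (x + y) = app x + app y;
    appZ : forall (k : R[i]) x, dom x -> app (k *: x) = k *: app x;
    app_mact : forall (a : A) x, dom x -> app (mact x a) = mact (app x) a
  }.

Section Operations.
Variables (R : realType) (A : cstarAlgType R) (E F : semiInnerModType A).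
Implicit Types (t s : unbOp E F) (T : adjOp E F).

Definition graph t : set (E * F) := [set (x, t x) | x in dom t].

Program Definition unbOp_of_adjOp T : unbOp E F :=
  @UnbOp R A E F setT T _ _ _ _.
Next Obligation. by []. Qed.
Next Obligation. by move=> T x y _ _; exact: adjOpD. Qed.
Next Obligation. by move=> T k x _; exact: adjOpZ. Qed.
Next Obligation. by move=> T a x _; exact: adjOp_mact. Qed.

(* The sum lives on the intersection of the domains; it has domain D(t) as soon
   as D(t) is contained in D(s). *)
Program Definition unbOp_add t s : unbOp E F :=
  @UnbOp R A E F (dom t `&` dom s) (fun x => t x + s x) _ _ _ _.
Next Obligation.
move=> t s; have [t0 tD tZ ta] := dom_submodule t.
have [s0 sD sZ sa] := dom_submodule s.
split=> // [x y [tx sx] [ty sy]|k x [tx sx]|a x [tx sx]]; split; auto.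
Qed.
Next Obligation.
by move=> t s x y [tx sx] [ty sy]; rewrite !appD// addrACA.
Qed.
Next Obligation. by move=> t s k x [tx sx]; rewrite !appZ// scalerDr. Qed.
Next Obligation. by move=> t s a x [tx sx]; rewrite !app_mact// mactDl. Qed.

(* The graph of t^*, where t^* y = z means <t x, y> = <x, z> for x in D(t). *)
Definition adjoint_graph t : set (F * E) :=
  [set p | forall x, dom t x -> inner (t x) p.1 = inner x p.2].

End Operations.

Section Composition.
Variables (R : realType) (A : cstarAlgType R) (E F H : semiInnerModType A).

Program Definition unbOp_comp (s : unbOp F H) (t : unbOp E F) : unbOp E H :=
  @UnbOp R A E H (dom t `&` t @^-1` dom s) (fun x => s (t x)) _ _ _ _.
Next Obligation.
move=> s t; have [t0 tD tZ ta] := dom_submodule t.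
have [s0 sD sZ sa] := dom_submodule s.
have app0 : t 0 = 0 by rewrite -(scale0r (0 : E)) appZ// scale0r.
split=> [|x y [tx stx] [ty sty]|k x [tx stx]|a x [tx stx]].
- by split=> //=; rewrite app0.
- by split=> /=; [exact: tD|rewrite appD//; exact: sD].
- by split=> /=; [exact: tZ|rewrite appZ//; exact: sZ].
- by split=> /=; [exact: ta|rewrite app_mact//; exact: sa].
Qed.
Next Obligation.
by move=> s t x y [tx stx] [ty sty]; rewrite !appD.
Qed.
Next Obligation. by move=> s t k x [tx stx]; rewrite !appZ. Qed.
Next Obligation. by move=> s t a x [tx stx]; rewrite !app_mact. Qed.

End Composition.

(* The module E(t): the domain of t with inner product <x, y> + <t x, t y>.
   It is a Hilbert C*-module when t is closed, but only the semi-inner-product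
   structure is needed to speak of compact operators on it. *)
Section GraphModule.
Variables (R : realType) (A : cstarAlgType R) (E F : semiInnerModType A).
Variable t : unbOp E F.

Definition dom_pred : {pred E} := fun x => `[< dom t x >].

Fact dom_pred_submod : GRing.submod_closed dom_pred.
Proof.
have [d0 dD dZ _] := dom_submodule t; split; first exact/asboolP.
by move=> k x y /asboolP dx /asboolP dy; apply/asboolP/dD => //; exact: dZ.
Qed.

HB.instance Definition _ :=
  GRing.isSubmodClosed.Build R[i] E dom_pred dom_pred_submod.

Record graphMod := GraphMod { gval : E; _ : gval \in dom_pred }.

HB.instance Definition _ := [isSub for gval].
HB.instance Definition _ := [Choice of graphMod by <:].
HB.instance Definition _ := [SubChoice_isSubLmodule of graphMod by <:].

Implicit Types (x y z : graphMod) (a b : A).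

Fact graph_mact_subproof x a : mact (gval x) a \in dom_pred.
Proof.
have [_ _ _ da] := dom_submodule t.
by apply/asboolP/da/asboolP; case: x.
Qed.

Definition graph_mact x a : graphMod := GraphMod (graph_mact_subproof x a).

Definition graph_inner x y : A :=
  inner (gval x) (gval y) + inner (t (gval x)) (t (gval y)).

Fact gval_dom x : dom t (gval x).
Proof. by case: x => x dx; apply/asboolP. Qed.

Fact graph_mactDl x y a : graph_mact (x + y) a = graph_mact x a + graph_mact y a.
Proof. by apply: val_inj; rewrite /= mactDl. Qed.

Fact graph_mactDr x a b : graph_mact x (a + b) = graph_mact x a + graph_mact x b.
Proof. by apply: val_inj; rewrite /= mactDr. Qed.

Fact graph_mactM x a b :
  graph_mact x (cmul a b) = graph_mact (graph_mact x a) b.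
Proof. by apply: val_inj; rewrite /= mactM. Qed.

Fact graph_mactZl (k : R[i]) x a : graph_mact (k *: x) a = k *: graph_mact x a.
Proof. by apply: val_inj; rewrite /= mactZl. Qed.

Fact graph_mactZr (k : R[i]) x a : graph_mact x (k *: a) = k *: graph_mact x a.
Proof. by apply: val_inj; rewrite /= mactZr. Qed.

Fact graph_innerDr x y z :
  graph_inner x (y + z) = graph_inner x y + graph_inner x z.
Proof.
rewrite /graph_inner; have -> : gval (y + z) = gval y + gval z by [].
by rewrite (appD (gval_dom y) (gval_dom z)) !innerDr addrACA.
Qed.

Fact graph_innerZr (k : R[i]) x y : graph_inner x (k *: y) = k *: graph_inner x y.
Proof.
rewrite /graph_inner; have -> : gval (k *: y) = k *: gval y by [].
by rewrite (appZ k (gval_dom y)) !innerZr scalerDr.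
Qed.

Fact graph_inner_mact x y a :
  graph_inner x (graph_mact y a) = cmul (graph_inner x y) a.
Proof.
by rewrite /graph_inner /= (app_mact a (gval_dom y)) !inner_mact cmulDl.
Qed.

Fact graph_inner_star x y : cstar (graph_inner x y) = graph_inner y x.
Proof. by rewrite /graph_inner cstarD !inner_star. Qed.

Fact graph_inner_ge0 x : cpositive (graph_inner x x).
Proof. exact: cpositiveD (inner_ge0 _) (inner_ge0 _). Qed.

HB.instance Definition _ := @isSemiInnerModule.Build R A graphMod
  graph_mact graph_inner graph_mactDl graph_mactDr graph_mactM graph_mactZl
  graph_mactZr graph_innerDr graph_innerZr graph_inner_mact graph_inner_star
  graph_inner_ge0.

End GraphModule.

Section Fredholm.
Variables (R : realType) (A : cstarAlgType R) (E : hilbertModType A).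
Implicit Types (t s : unbOp E E) (G T : adjOp E E).

Definition regular_op t : Prop :=
  [/\ closed (graph t), dense (dom t),
      dense [set y | exists z, adjoint_graph t (y, z)]
    & dense [set w | exists x z,
        [/\ dom t x, adjoint_graph t (t x, z) & w = x + z]]].

Definition selfadjoint_op t : Prop := graph t = adjoint_graph t.

Definition closable_op t : Prop :=
  forall x y z, closure (graph t) (x, y) -> closure (graph t) (x, z) -> y = z.

Definition closure_one_mod_compact t : Prop :=
  closable_op t /\
  exists T, closure (graph t) = graph (unbOp_of_adjOp T) /\
            compact_op (fun x => T x - x).

Definition pseudo_left_inverse t G : Prop :=
  closure_one_mod_compact (unbOp_comp (unbOp_of_adjOp G) t).

Definition pseudo_right_inverse t G : Prop :=
  closure_one_mod_compact (unbOp_comp t (unbOp_of_adjOp G)).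

Definition fredholm_op t : Prop :=
  (exists G, pseudo_left_inverse t G) /\ (exists G, pseudo_right_inverse t G).

(* Graphs of regular operators are orthogonally complemented, so that a point q
   as below exists and is unique. *)
Definition graph_proj t (p : E * E) : E * E :=
  xget 0 [set q | graph t q /\ forall r, graph t r -> inner r (p - q) = 0].

Definition gap t s : R := opnorm (fun p => graph_proj t p - graph_proj s p).

Definition relatively_compact t s : Prop :=
  dom t `<=` dom s /\ compact_op (fun x : graphMod t => s (gval x)).

End Fredholm.

(* Main.v *)
(* A regular operator t is Fredholm iff t and its adjoint both have a right
   parametrix: adjointable G, T with (G x, T x) in the graph for all x and T - 1
   compact (a left inverse of t is the adjoint of a right inverse of the
   adjoint).  If G, T + S lie in the graph of a perturbed operator and S has
   small norm, composing with (1 + S)^-1 gives a right parametrix again.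
   For D + t take S = D G; for s close to t in the gap metric project (G x, T x)
   onto the graph of s, or onto its orthogonal for the adjoint; for t + s
   selfadjoint take S = s G, which is compact if s is t-compact.

   Regularity is handled through orthogonal decompositions: if t is regular,
   every (u, v) is the sum of an element of the graph and of one orthogonal to
   it, a property stable under small bounded perturbations by a contraction
   argument.  For symmetric operators it amounts to surjectivity of t + i and
   t - i, which is obtained for t + s as in the Kato-Rellich theorem.  If s is
   t-compact its t-bound is 0 because the domain of t is dense, so t + s + i mu
   is onto for large |mu|, and then for |mu| = 1.

   All norm estimates rest on the inequality |a| <= |a + b| for sums of squares
   a and b in a C*-algebra, that is on the positivity of a^* a. *)
Require Import Defs.
From mathcomp Require Import all_boot all_order all_algebra.
From mathcomp Require Import complex ring lra.
From mathcomp Require Import all_classical all_reals all_analysis.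

Set Implicit Arguments.
Unset Strict Implicit.
Unset Printing Implicit Defensive.

Import Order.TTheory GRing.Theory Num.Theory.
Import numFieldNormedType.Exports.

Local Open Scope classical_set_scope.
Local Open Scope ring_scope.

(** * Linear identities and the real-valued norm *)

(** Syntax for a reflective procedure: an equation between linear combinations becomes one scalar
    equation per atom, which is left to [ring]. *)
Inductive lexp (K : Type) :=
  | LZero | LVar of nat | LAdd of lexp K & lexp K | LOpp of lexp K
  | LScale of K & lexp K.
Arguments LZero {K}.
Arguments LVar {K}.

Section LinearExpressions.
Variables (K : pzRingType) (V : lmodType K).
Implicit Types (env : seq V) (e : lexp K).

Fixpoint leval env e : V :=
  match e with
  | LZero => 0
  | LVar i => nth 0 env i
  | LAdd e1 e2 => leval env e1 + leval env e2
  | LOpp e1 => - leval env e1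
  | LScale k e1 => k *: leval env e1
  end.

Fixpoint lcoef e (i : nat) : K :=
  match e with
  | LZero => 0
  | LVar j => if eqn i j then 1 else 0
  | LAdd e1 e2 => lcoef e1 i + lcoef e2 i
  | LOpp e1 => - lcoef e1 i
  | LScale k e1 => k * lcoef e1 i
  end.

(** A recursive conjunction instead of a bounded quantifier, so that it computes to one goal per
    atom. *)
Fixpoint lcoef_eq e1 e2 (n : nat) : Prop :=
  match n with
  | 0 => True
  | n.+1 => lcoef_eq e1 e2 n /\ lcoef e1 n = lcoef e2 n
  end.

Lemma levalE env e : leval env e = \sum_(i < size env) lcoef e i *: env`_i.
Proof.
elim: e => /= [|j|e1 -> e2 ->|e1 ->|k e1 ->].
- by rewrite big1// => i _; rewrite scale0r.
- have ij i : eqn i j = (i == j) by [].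
  case: (ltnP j (size env)) => js.
    rewrite (bigD1 (Ordinal js))//= ij eqxx scale1r big1 ?addr0// => i.
    by rewrite -val_eqE ij /= => /negPf ->; rewrite scale0r.
  rewrite nth_default// big1// => i _; rewrite ij ltn_eqF ?scale0r//.
  exact: leq_trans (ltn_ord i) js.
- by rewrite -big_split; apply: eq_bigr => i _; rewrite scalerDl.
- by rewrite -sumrN; apply: eq_bigr => i _; rewrite scaleNr.
- by rewrite scaler_sumr; apply: eq_bigr => i _; rewrite scalerA.
Qed.

Lemma leval_eq env e1 e2 : lcoef_eq e1 e2 (size env) ->
  leval env e1 = leval env e2.
Proof.
move=> h; rewrite !levalE; apply: eq_bigr => -[i /= si] _; congr (_ *: _).
elim: (size env) h si => //= n IH [hn en]; rewrite ltnS leq_eqVlt.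
by case/orP=> [/eqP->//|]; exact: IH.
Qed.

End LinearExpressions.

(** The match on the dummy term [Set] runs the tactic [constr_eq] while a value is being computed;
    its failure selects the next branch. *)
Ltac lin_mem x env :=
  lazymatch env with
  | nil => false
  | cons ?y ?env' =>
    match constr:(Set) with
    | _ => let _ := match constr:(Set) with _ => constr_eq x y end in true
    | _ => lin_mem x env'
    end
  end.
Ltac lin_index x env :=
  lazymatch env with
  | cons ?y ?env' =>
    match constr:(Set) with
    | _ => let _ := match constr:(Set) with _ => constr_eq x y end in
           constr:(O)
    | _ => let n := lin_index x env' in constr:(S n)
    end
  end.
Ltac lin_env t env :=
  lazymatch t with
  | GRing.zero => env
  | GRing.add ?a ?b => let env := lin_env a env in lin_env b env
  | GRing.opp ?a => lin_env a env
  | GRing.scale _ ?a => lin_env a env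
  | _ => lazymatch lin_mem t env with
         | true => env | false => constr:(cons t env) end
  end.
Ltac lin_reify K t env :=
  lazymatch t with
  | GRing.zero => constr:(@LZero K)
  | GRing.add ?a ?b =>
    let e1 := lin_reify K a env in let e2 := lin_reify K b env in
    constr:(@LAdd K e1 e2)
  | GRing.opp ?a => let e1 := lin_reify K a env in constr:(@LOpp K e1)
  | GRing.scale ?k ?a =>
    let e1 := lin_reify K a env in constr:(@LScale K k e1)
  | _ => let n := lin_index t env in constr:(@LVar K n)
  end.
(* Reduces an equation between linear combinations in a module over [K] to the
   equations between the coefficients in [K]. *)
Ltac linear_coefs K :=
  lazymatch goal with
  | |- @eq ?V ?a ?b =>
    let env := lin_env a (@nil V) in
    let env := lin_env b env in
    let e1 := lin_reify K a env in
    let e2 := lin_reify K b env in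
    refine (@leval_eq _ _ env e1 e2 _);
    cbv [lcoef_eq lcoef size eqn]; repeat split
  end.


Ltac lin :=
  lazymatch goal with R : Real.type |- _ => linear_coefs (complex R); ring end.

Notation cplx := (real_complex _).

Section RealNorm.
Variables (R : realType) (V : normedModType R[i]).
Implicit Types x y z : V.

(** The norm of a module over [R[i]] has values in [R[i]]; its real part brings estimates within
    reach of [lra]. *)
Definition nrm x : R := complex.Re `|x|.

Lemma nrmE x : `|x| = cplx (nrm x).
Proof. by rewrite /nrm RRe_real// normr_real. Qed.

Lemma nrm_ge0 x : 0 <= nrm x.
Proof. by rewrite -ler0c -nrmE. Qed.

Lemma nrm0 : nrm 0 = 0.
Proof. by rewrite /nrm normr0. Qed.

Lemma nrm_eq0 x : nrm x = 0 -> x = 0.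
Proof. by move=> x0; apply/normr0_eq0; rewrite nrmE x0. Qed.

Lemma nrm_le0 x : nrm x <= 0 -> x = 0.
Proof. by move=> x0; apply/nrm_eq0/le_anti; rewrite x0 nrm_ge0. Qed.

Lemma nrmD x y : nrm (x + y) <= nrm x + nrm y.
Proof. by rewrite -lecR rmorphD /= -!nrmE ler_normD. Qed.

Lemma nrmN x : nrm (- x) = nrm x.
Proof. by rewrite /nrm normrN. Qed.

Lemma nrmB x y : nrm (x - y) <= nrm x + nrm y.
Proof. by rewrite -(nrmN y) nrmD. Qed.

Lemma nrmC x y : nrm (x - y) = nrm (y - x).
Proof. by rewrite -nrmN opprB. Qed.

Lemma nrm_split y x z : nrm (x - z) <= nrm (x - y) + nrm (y - z).
Proof. by rewrite -(subrKA y x (- z)) nrmD. Qed.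

Lemma nrmZ (k : R[i]) x : nrm (k *: x) = complex.Re `|k| * nrm x.
Proof.
by apply: complexI; rewrite rmorphM /= -!nrmE normrZ.
Qed.

Lemma nrmZr (c : R) x : nrm (cplx c *: x) = `|c| * nrm x.
Proof.
rewrite nrmZ normc_def /= [0 ^+ 2]expr2 mul0r addr0.
by rewrite sqrtr_sqr.
Qed.

Lemma nrmZi x : nrm ('i%C *: x) = nrm x.
Proof.
by rewrite nrmZ normc_def /= expr0n /= add0r expr1n sqrtr1 mul1r.
Qed.

Lemma nrm_ball x y (e : R) : 0 < e ->
  ball x (cplx e) y <-> nrm (x - y) < e.
Proof. by move=> e0; rewrite -ball_normE /ball_ /= nrmE ltcR. Qed.

Lemma nbhs_nrm x (B : set V) : nbhs x B <->
  exists2 e : R, 0 < e & forall y, nrm (x - y) < e -> B y.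
Proof.
split=> [/nbhs_ballP [e /= e0 eB]|[e e0 eB]].
  have eE : e = cplx (complex.Re e) by rewrite RRe_real// gtr0_real.
  move: (e0); rewrite eE -[0]/(cplx 0) ltcR => e0'.
  by exists (complex.Re e) => // y xy; apply: eB; rewrite eE; apply/nrm_ball.
apply/nbhs_ballP; exists (cplx e) => [|y /nrm_ball xy]; last exact/eB/xy.
by rewrite /= -[0]/(cplx 0) ltcR.
Qed.

Lemma dense_nrm (S : set V) : dense S ->
  forall x (e : R), 0 < e -> exists2 y, S y & nrm (x - y) < e.
Proof.
move=> Sd x e e0; have e0' : 0 < cplx e by rewrite -[0]/(cplx 0) ltcR.
have [] := Sd (interior (ball x (cplx e))).
- by exists x; apply: nbhsx_ballx.
- exact: open_interior.
move=> y [/interior_subset/nrm_ball xy Sy].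
by exists y => //; apply: xy.
Qed.

Lemma nrm_dense (S : set V) :
  (forall x (e : R), 0 < e -> exists2 y, S y & nrm (x - y) < e) -> dense S.
Proof.
move=> h O [x Ox] Oo; have /nbhs_nrm[e e0 eO] : nbhs x O.
  exact: open_nbhs_nbhs.
by have [y Sy xy] := h x e e0; exists y; split => //; exact: eO.
Qed.

End RealNorm.

Lemma closure_nrm (R : realType) (V : normedModType R[i]) (S : set (V * V))
    (x y : V) : closure S (x, y) <->
  forall e : R, 0 < e ->
    exists u v, [/\ S (u, v), nrm (x - u) < e & nrm (y - v) < e].
Proof.
split=> [Sxy e e0|h B].
  have [|[u v] [Suv [xu yv]]] :=
    Sxy ([set u | nrm (x - u) < e] `*` [set v | nrm (y - v) < e]).
    exists ([set u | nrm (x - u) < e], [set v | nrm (y - v) < e]) => //.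
    by split; apply/nbhs_nrm; exists e.
  by exists u, v.
move=> [[P Q] [/= /nbhs_nrm[d d0 dP] /nbhs_nrm[d' d0' dQ]] PQ].
have m0 : 0 < Num.min d d' by rewrite lt_min d0 d0'.
have [u [v [Suv xu yv]]] := h _ m0.
exists (u, v); split=> //; apply: PQ; split=> /=.
  by apply: dP; rewrite (lt_le_trans xu)// ge_min lexx.
by apply: dQ; rewrite (lt_le_trans yv)// ge_min lexx orbT.
Qed.

(** Stated for an arbitrary function [n], so that the contraction principle also applies to [E * E]
    with the sum of the two norms. *)
Definition n_complete (R : realType) (V : zmodType) (n : V -> R) :=
  forall u : nat -> V,
  (forall e, 0 < e -> exists N, forall i j, (N <= i)%N -> (N <= j)%N ->
     n (u i - u j) < e) ->
  exists l, forall e, 0 < e ->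
    exists N, forall i, (N <= i)%N -> n (l - u i) < e.

Lemma nrm_complete (R : realType) (V : completeNormedModType R[i]) :
  n_complete (@nrm R V).
Proof.
move=> u cu; have /cvg_ex[l ul] : cvg (u @ \oo).
  apply: cauchy_cvg; apply/cauchy_exP => e e0.
  have eE : e = cplx (complex.Re e) by rewrite RRe_real// gtr0_real.
  move: (e0); rewrite eE -[0]/(cplx 0) ltcR => e0'.
  have [N uN] := cu _ e0'; exists (u N); exists N => // i /= Ni.
  by apply/nrm_ball => //; exact: uN.
exists l => e e0; have e0' : 0 < cplx e by rewrite -[0]/(cplx 0) ltcR.
have /cvgrPdist_lt/(_ _ e0')[N _ uN] := ul.
by exists N => i Ni; have := uN i Ni; rewrite /= nrmE ltcR.
Qed.


(** The majorant [q] is nondecreasing and bounded, so beyond an index where it is within [e] of its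
    supremum its increments stay below [e]. *)
Lemma majorized_cauchy (R : realType) (d : nat -> nat -> R) (q : nat -> R)
    (B : R) :
  (forall i j, d i j = d j i) ->
  (forall i j, (i <= j)%N -> d j i <= q j - q i) ->
  (forall i j, 0 <= d i j) -> (forall i, q i <= B) ->
  forall e, 0 < e ->
    exists N, forall i j, (N <= i)%N -> (N <= j)%N -> d i j < e.
Proof.
move=> dC dq d0 qB e e0.
have [] := @sup_adherent R (range q) e e0.
  by split; [exists (q 0); exists 0|exists B => _ [i _ <-]].
move=> _ [N _ <-] Ne; exists N.
have qs i : q i <= sup (range q).
  apply: ub_le_sup; last by exists i.
  by exists B => _ [j _ <-].
suff h i j : (N <= i)%N -> (i <= j)%N -> d j i < e.
  move=> i j Ni Nj; have [ij|/ltnW ji] := leqP i j; last exact: h.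
  by rewrite dC; exact: h.
move=> Ni ij; apply: le_lt_trans (dq _ _ ij) _.
have := le_trans (d0 _ _) (dq _ _ Ni); have := qs j; lra.
Qed.

(** * Contraction principle and perturbation of surjective maps *)

Section Contraction.
Variables (R : realType) (V : zmodType) (n : V -> R).
Hypotheses (n_compl : n_complete n) (n_ge0 : forall x, 0 <= n x)
  (n0 : n 0 = 0) (n_le0 : forall x, n x <= 0 -> x = 0)
  (nD : forall x y, n (x + y) <= n x + n y) (nN : forall x, n (- x) = n x).

Lemma contraction_fixpoint (f : V -> V) (r : R) : 0 <= r -> r < 1 ->
  (forall x y, n (f x - f y) <= r * n (x - y)) -> exists x, f x = x.
Proof.
move=> r0 r1 fr; pose u i := iter i f 0; pose c := n (f 0).
have nC x y : n (x - y) = n (y - x) by rewrite -nN opprB.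
have nsplit y x z : n (x - z) <= n (x - y) + n (y - z).
  by rewrite -(subrKA y x (- z)).
have c0 : 0 <= c by exact: n_ge0.
have r1' : 1 - r != 0 by rewrite subr_eq0 eq_sym lt_eqF.
have step i : n (u i.+1 - u i) <= r ^+ i * c.
  elim: i => [|i IH]; first by rewrite /= subr0 expr0 mul1r.
  by rewrite (le_trans (fr _ _))// exprS -mulrA ler_wpM2l.
(* Partial sums of the geometric series that dominates the increments of [u]. *)
pose q i := c * (1 - r ^+ i) / (1 - r).
have qS i : q i.+1 - q i = r ^+ i * c by rewrite /q exprS; field.
have /n_compl[l ul] : forall e, 0 < e -> exists N, forall i j,
    (N <= i)%N -> (N <= j)%N -> n (u i - u j) < e.
  apply: (@majorized_cauchy _ (fun i j => n (u i - u j)) q (c / (1 - r))) => //.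
  - move=> i j /subnK <-; elim: (j - i)%N => [|k IH].
      by rewrite add0n !subrr n0.
    rewrite addSn (le_trans (nsplit (u (k + i)%N) _ _))//.
    by have := qS (k + i)%N; have := step (k + i)%N; lra.
  - move=> k; rewrite /q ler_wpM2r ?invr_ge0 ?subr_ge0 ?(ltW r1)//.
    by rewrite ler_piMr// gerBl exprn_ge0.
exists l; apply/eqP; rewrite -subr_eq0; apply/eqP/n_le0.
apply/ler_addgt0Pr => e e0; rewrite add0r.
have e20 : 0 < e / 2 by lra.
have [N uN] := ul _ e20; have := uN N (leqnn _); have := uN N.+1 (leqnSn _).
have := fr l (u N); have := nsplit (u N.+1) (f l) l.
rewrite (nC (u N.+1) l) -/(u N.+1) => h1 h2 h3 h4.
have : r * n (l - u N) <= n (l - u N) by rewrite ler_piMl// ltW.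
by move: h1 h2 h3 h4 => /=; lra.
Qed.

(** With [g] a right inverse of [P], a fixed point [v] of the contraction [v |-> w - W (g v)] gives
    the solution [g v]. The domain is only a set with a subtraction, which covers both domains of
    unbounded operators and triples of vectors. *)
Lemma onto_perturb (X : Type) (D : set X) (sub : X -> X -> X) (P W : X -> V)
    (r : R) : 0 <= r -> r < 1 ->
  (forall x y, D x -> D y -> [/\ D (sub x y), P (sub x y) = P x - P y
                               & W (sub x y) = W x - W y]) ->
  (forall w, exists2 x, D x & P x = w) ->
  (forall x, D x -> n (W x) <= r * n (P x)) ->
  forall w, exists2 x, D x & P x + W x = w.
Proof.
move=> r0 r1 subE Ponto WP w.
have /boolp.choice[g gP] : forall v, exists x, D x /\ P x = v.
  by move=> v; have [x] := Ponto v; exists x.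
have /(contraction_fixpoint r0 r1)[v vE] : forall v1 v2,
    n (w - W (g v1) - (w - W (g v2))) <= r * n (v1 - v2).
  move=> v1 v2.
  have [D1 P1] := gP v1; have [D2 P2] := gP v2.
  have [Ds Ps Ws] := subE _ _ D2 D1.
  have -> : w - W (g v1) - (w - W (g v2)) = W (g v2) - W (g v1).
    by rewrite opprB addrC subrKA.
  by rewrite -Ws (le_trans (WP _ Ds))// Ps P1 P2 -nN opprB.
have [Dv Pv] := gP v; exists (g v) => //.
by rewrite Pv -{1}vE subrK.
Qed.

End Contraction.

(** * Positivity in a C*-algebra *)

Lemma nrm_small_eq (R : realType) (V : normedModType R[i]) (x y : V) (C : R) :
  (forall e, 0 < e -> nrm (x - y) <= C * e) -> x = y.
Proof.
move=> h; apply/eqP; rewrite -subr_eq0; apply/eqP/nrm_le0.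
apply/ler_addgt0Pr => e e0; rewrite add0r.
have C0 : 0 < `|C| + 1 by rewrite ltr_wpDl.
have d0 : 0 < e / (`|C| + 1) by rewrite divr_gt0.
rewrite (le_trans (h _ d0))// (@le_trans _ _ ((`|C| + 1) * (e / (`|C| + 1))))//.
  by rewrite ler_wpM2r ?(ltW d0)// (le_trans (ler_norm _))// lerDl.
by rewrite mulrC divfK// gt_eqF.
Qed.

Lemma conj_i (R : realType) : conjc 'i%C = - 'i%C :> R[i].
Proof. by rewrite -[RHS]/(Complex (- 0) (- 1)) oppr0. Qed.

Lemma conj_Ni (R : realType) : conjc (- 'i%C) = 'i%C :> R[i].
Proof. by rewrite -conj_i conjcK. Qed.

Section CStar.
Variables (R : realType) (A : cstarAlgType R).
Implicit Types (a b x y z w : A) (f g h : A -> A).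

Lemma cmul0r a : cmul 0 a = 0.
Proof. by have := cmulZl 0 0 a; rewrite !scale0r. Qed.

Lemma cmulr0 a : cmul a 0 = 0.
Proof. by have := cmulZr 0 a 0; rewrite !scale0r. Qed.

Lemma cmulNl a b : cmul (- a) b = - cmul a b.
Proof. by rewrite -scaleN1r cmulZl scaleN1r. Qed.

Lemma cmulNr a b : cmul a (- b) = - cmul a b.
Proof. by rewrite -scaleN1r cmulZr scaleN1r. Qed.

Lemma cstarN a : cstar (- a) = - cstar a.
Proof. by rewrite -scaleN1r cstarZ rmorphN rmorph1 scaleN1r. Qed.

Lemma cstar0 : cstar (0 : A) = 0.
Proof. by have := cstarZ 0 (0 : A); rewrite rmorph0 !scale0r. Qed.

Lemma nrm_cmul a b : nrm (cmul a b) <= nrm a * nrm b.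
Proof. by rewrite -lecR rmorphM /= -!nrmE cnormM. Qed.

Lemma nrm_cstar_mul a : nrm (cmul (cstar a) a) = nrm a ^+ 2.
Proof. by apply: complexI; rewrite rmorphXn /= -!nrmE cnorm_star. Qed.

Lemma nrm_cstar a : nrm (cstar a) = nrm a.
Proof.
suff h b : nrm b <= nrm (cstar b).
  by apply/le_anti; rewrite h -{2}(cstarK a) h.
have := nrm_ge0 b; rewrite le_eqVlt => /orP[/eqP<-|b0]; first exact: nrm_ge0.
by rewrite -(ler_pM2r b0) -expr2 -nrm_cstar_mul nrm_cmul.
Qed.

(* The inner product of [A] as a Hilbert module over itself. *)
Definition aip x y : A := cmul (cstar x) y.

Lemma aipDl x y z : aip (x + y) z = aip x z + aip y z.
Proof. by rewrite /aip cstarD cmulDl. Qed.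

Lemma aipDr x y z : aip x (y + z) = aip x y + aip x z.
Proof. exact: cmulDr. Qed.

Lemma aipZl (k : R[i]) x y : aip (k *: x) y = conjc k *: aip x y.
Proof. by rewrite /aip cstarZ cmulZl. Qed.

Lemma aipZr (k : R[i]) x y : aip x (k *: y) = k *: aip x y.
Proof. exact: cmulZr. Qed.

Lemma aipNl x y : aip (- x) y = - aip x y.
Proof. by rewrite /aip cstarN cmulNl. Qed.

Lemma aipNr x y : aip x (- y) = - aip x y.
Proof. exact: cmulNr. Qed.

Lemma aip_star x y : cstar (aip x y) = aip y x.
Proof. by rewrite /aip cstarM cstarK. Qed.

Lemma nrm_aip x y : nrm (aip x y) <= nrm x * nrm y.
Proof. by rewrite -(nrm_cstar x) nrm_cmul. Qed.

Lemma nrm_aip_id x : nrm (aip x x) = nrm x ^+ 2.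
Proof. exact: nrm_cstar_mul. Qed.

Lemma aip_inj x y : (forall z, aip z x = aip z y) -> x = y.
Proof.
move=> h; apply/eqP; rewrite -subr_eq0; apply/eqP/nrm_eq0/eqP.
by rewrite -sqrf_eq0 -nrm_aip_id aipDr aipNr h subrr nrm0.
Qed.

Definition aadj f g := forall z w, aip (f z) w = aip z (g w).

Lemma aadj_sym f g : aadj f g -> aadj g f.
Proof. by move=> fg z w; rewrite -aip_star -fg aip_star. Qed.

Section Adjointable.
Variables (f g : A -> A).
Hypothesis fg : aadj f g.

(** Linearity comes for free: across the inner product [f] disappears from the second argument,
    where [aip] is linear. *)
Lemma aadjD x y : f (x + y) = f x + f y.
Proof.
by apply: aip_inj => z; rewrite aipDr -!(aadj_sym fg) aipDr.
Qed.

Lemma aadjZ (k : R[i]) x : f (k *: x) = k *: f x.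
Proof.
by apply: aip_inj => z; rewrite aipZr -!(aadj_sym fg) aipZr.
Qed.

Lemma aadjN x : f (- x) = - f x.
Proof. by rewrite -scaleN1r aadjZ scaleN1r. Qed.

Lemma aadj0 : f 0 = 0.
Proof. by have := aadjZ 0 0; rewrite !scale0r. Qed.

End Adjointable.

Definition herm f := aadj f f.

Definition bnd f := exists2 M : R, 0 < M & forall z, nrm (f z) <= M * nrm z.

Definition fcomm f g := forall z, f (g z) = g (f z).

(** For selfadjoint [f] the bound [|c - f| <= c] means that the spectrum lies in [[0, 2 c]]; this
    avoids spectral theory. Operators on [A] replace elements of [A] because the identity operator
    exists even if [A] has no unit. *)
Definition positive_op f := herm f /\
  exists2 c : R, 0 < c & forall z, nrm (cplx c *: z - f z) <= c * nrm z.

Lemma herm_comp f g : herm f -> herm g -> fcomm f g -> herm (f \o g).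
Proof. by move=> hf hg fg z w; rewrite /= hf hg fg. Qed.

Lemma herm_lin f g (c d : R) : herm f -> herm g ->
  herm (fun z => cplx c *: f z + cplx d *: g z).
Proof.
by move=> hf hg z w; rewrite aipDl aipDr !aipZl !aipZr !conjc_real hf hg.
Qed.

Lemma herm_id : herm id. Proof. by []. Qed.

Lemma bnd_comp f g : bnd f -> bnd g -> bnd (f \o g).
Proof.
move=> [M M0 fM] [N N0 gN]; exists (M * N) => [|z]; first exact: mulr_gt0.
by rewrite /= (le_trans (fM _))// -mulrA ler_wpM2l// ltW.
Qed.

Lemma bnd_lin f g (c d : R) : bnd f -> bnd g ->
  bnd (fun z => cplx c *: f z + cplx d *: g z).
Proof.
move=> [M M0 fM] [N N0 gN]; exists (`|c| * M + `|d| * N + 1) => [|z].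
  by rewrite ltr_wpDl// addr_ge0// mulr_ge0// ltW.
rewrite (le_trans (nrmD _ _))// !nrmZr.
have h1 := ler_wpM2l (normr_ge0 c) (fM z).
have h2 := ler_wpM2l (normr_ge0 d) (gN z).
by have := nrm_ge0 z; rewrite !mulrDl -!mulrA; lra.
Qed.

Lemma bnd_id : bnd id.
Proof. by exists 1 => // z; rewrite mul1r. Qed.

Lemma positive_herm f : positive_op f -> herm f. Proof. by case. Qed.

Lemma positive_bnd f : positive_op f -> bnd f.
Proof.
move=> [_ [c c0 fc]]; exists (2 * c) => [|z]; first by lra.
have -> : f z = cplx c *: z - (cplx c *: z - f z) by lin.
rewrite (le_trans (nrmB _ _))// nrmZr gtr0_norm//; have := fc z; lra.
Qed.

Lemma positive_ext f g : f =1 g -> positive_op f -> positive_op g.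
Proof. by move=> /funext ->. Qed.

Lemma positive_add f g :
  positive_op f -> positive_op g -> positive_op (fun z => f z + g z).
Proof.
move=> [hf [c c0 fc]] [hg [d d0 gd]]; split.
  by move=> z w; rewrite aipDl aipDr hf hg.
exists (c + d) => [|z]; first exact: addr_gt0.
have -> : cplx (c + d) *: z - (f z + g z)
  = (cplx c *: z - f z) + (cplx d *: z - g z) by lin.
by rewrite (le_trans (nrmD _ _))// mulrDl lerD.
Qed.

Lemma positive_scale f (k : R) : 0 < k ->
  positive_op f -> positive_op (fun z => cplx k *: f z).
Proof.
move=> k0 [hf [c c0 fc]]; split.
  by move=> z w; rewrite aipZl aipZr conjc_real hf.
exists (k * c) => [|z]; first exact: mulr_gt0.
have -> : cplx (k * c) *: z - cplx k *: f z = cplx k *: (cplx c *: z - f z).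
  by lin.
by rewrite nrmZr gtr0_norm// -mulrA ler_wpM2l// ltW.
Qed.

Lemma positive0 : positive_op (fun=> 0).
Proof.
split=> [z w|]; first by rewrite /aip cstar0 cmul0r cmulr0.
by exists 1 => // z; rewrite subr0 nrmZr normr1.
Qed.

End CStar.

(** * Square roots of positive operators by iteration *)

Section SquareRoot.
Variables (R : realType) (A : cstarAlgType R).
Implicit Types (x y z w : A) (f g h : A -> A).

(** A limit [Y] satisfies [2 Y = (1 - f) + Y^2], that is [(1 - Y)^2 = f]. *)
Fixpoint sqrt_iter f (n : nat) : A -> A :=
  if n is n.+1 then
    fun z => cplx (2^-1) *: ((z - f z) + sqrt_iter f n (sqrt_iter f n z))
  else fun=> 0.

(* Majorizes [sqrt_iter]: it is the same iteration for the number [0]. *)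
Fixpoint sqrt_bound (n : nat) : R :=
  if n is n.+1 then (1 + sqrt_bound n ^+ 2) / 2 else 0.

Lemma sqrt_bound01 n : 0 <= sqrt_bound n <= 1.
Proof.
elim: n => [|n /andP[q0 q1]] /=; first by rewrite lexx ler01.
have : sqrt_bound n ^+ 2 <= 1 by rewrite expr_le1.
by have := sqr_ge0 (sqrt_bound n); lra.
Qed.

Lemma sqrt_boundS n : sqrt_bound n <= sqrt_bound n.+1.
Proof. by have /= := sqr_ge0 (1 - sqrt_bound n); nra. Qed.

Section Iteration.
Variable f : A -> A.
Hypotheses (hf : herm f) (f1 : forall z, nrm (z - f z) <= nrm z).
Local Notation y := (sqrt_iter f).
Local Notation q := sqrt_bound.

Lemma sqrt_iter_herm n : herm (y n).
Proof.
elim: n => [|n IH] z w; first by rewrite /= /aip cstar0 cmul0r cmulr0.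
by rewrite /= aipZl aipZr conjc_real !(aipDl, aipDr, aipNl, aipNr) hf !IH.
Qed.

Lemma sqrt_iter_bnd n z : nrm (y n z) <= q n * nrm z.
Proof.
elim: n z => [|n IH] z /=; first by rewrite nrm0 mul0r.
rewrite nrmZr ger0_norm ?invr_ge0//.
have h1 := nrmD (z - f z) (y n (y n z)); have h2 := IH (y n z).
have /andP[q0 _] := sqrt_bound01 n; have h3 := ler_wpM2l q0 (IH z).
have h4 := f1 z; move: h1 h2 h3 h4; nra.
Qed.

Lemma sqrt_iter_comm g n : herm g -> fcomm f g -> fcomm (y n) g.
Proof.
move=> hg fg; elim: n => [|n IH] z /=; first by rewrite (aadj0 hg).
by rewrite (aadjZ hg) !(aadjD hg) (aadjN hg) fg !IH.
Qed.

Lemma sqrt_iter_commute m n : fcomm (y m) (y n).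
Proof.
apply: sqrt_iter_comm; first exact: sqrt_iter_herm.
by move=> z; rewrite sqrt_iter_comm.
Qed.

(** The iterates commute, so [y_(m+1) - y_(n+1)] factors as [(y_m + y_n) (y_m - y_n) / 2], and the
    numbers [q] obey the same identity. *)
Lemma sqrt_iter_diff m n z : (n <= m)%N ->
  nrm (y m z - y n z) <= (q m - q n) * nrm z.
Proof.
elim: n m z => [|n IH] [|m] z // nm.
- by rewrite subrr nrm0 subrr mul0r.
- by rewrite subr0 subr0 sqrt_iter_bnd.
have hm := sqrt_iter_herm m; have hn := sqrt_iter_herm n.
have -> : y m.+1 z - y n.+1 z
    = cplx 2^-1 *: (y m (y m z - y n z) + y n (y m z - y n z)).
  rewrite /= !(aadjD hm, aadjD hn, aadjN hm, aadjN hn).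
  by rewrite (sqrt_iter_commute m n); lin.
rewrite nrmZr ger0_norm ?invr_ge0//=.
set d := y m z - y n z.
have h1 := nrmD (y m d) (y n d); have h2 := sqrt_iter_bnd m d.
have h3 := sqrt_iter_bnd n d; have h4 := IH m z nm.
have /andP[q0 _] := sqrt_bound01 n; have /andP[q0' _] := sqrt_bound01 m.
have h5 := ler_wpM2l (addr_ge0 q0 q0') h4.
rewrite -/d in h5; move: h1 h2 h3 h5; lra.
Qed.

Lemma sqrt_iter_lim : exists Y : A -> A, forall z e, 0 < e ->
  exists N, forall n, (N <= n)%N -> nrm (Y z - y n z) < e.
Proof.
suff /boolp.choice[Y YP] : forall z, exists l, forall e, 0 < e ->
    exists N, forall n, (N <= n)%N -> nrm (l - y n z) < e by exists Y.
move=> z; apply: (@nrm_complete R A) => e e0.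
apply: (@majorized_cauchy _ (fun i j => nrm (y i z - y j z))
  (fun i => q i * nrm z) (nrm z)) => //.
- by move=> i j; rewrite nrmC.
- by move=> i j ij; rewrite -mulrBl sqrt_iter_diff.
- by move=> i j; exact: nrm_ge0.
- by move=> i; rewrite ler_piMl ?nrm_ge0//; have /andP[] := sqrt_bound01 i.
Qed.

(** The root is [1 - Y] with [Y] the pointwise limit of the iterates; symmetry, the recursion and
    commutation all pass to the limit. *)
Lemma sqrt_contraction : exists r, [/\ herm r, forall z, r (r z) = f z,
  forall z, nrm (z - r z) <= nrm z
  & forall g, herm g -> bnd g -> fcomm f g -> fcomm r g].
Proof.
have [Y Ylim] := sqrt_iter_lim.
have Ybnd z : nrm (Y z) <= nrm z.
  apply/ler_addgt0Pr => e /(Ylim z)[N /(_ N (leqnn _)) h].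
  have := nrmD (Y z - y N z) (y N z); rewrite subrK => h1.
  have h2 := sqrt_iter_bnd N z; have /andP[_ q1] := sqrt_bound01 N.
  by have := ler_wpM2r (nrm_ge0 z) q1; lra.
have Yherm : herm Y.
  move=> z w; apply: (@nrm_small_eq _ _ _ _ (nrm z + nrm w)) => e e0.
  have [N1 h1] := Ylim z e e0.
  have [N2 h2] := Ylim w e e0.
  pose n := maxn N1 N2; have {}h1 := h1 n (leq_maxl _ _).
  have {}h2 := h2 n (leq_maxr _ _).
  have -> : aip (Y z) w - aip z (Y w)
      = aip (Y z - y n z) w - aip z (Y w - y n w).
    by rewrite !(aipDl, aipDr, aipNl, aipNr) sqrt_iter_herm; lin.
  rewrite (le_trans (nrmB _ _))// mulrC.
  have h3 := nrm_aip (Y z - y n z) w; have h4 := nrm_aip z (Y w - y n w).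
  have := ler_wpM2r (nrm_ge0 w) (ltW h1).
  by have := ler_wpM2l (nrm_ge0 z) (ltW h2); lra.
have YY z : Y z = cplx 2^-1 *: ((z - f z) + Y (Y z)).
  apply: (@nrm_small_eq _ _ _ _ 2) => e e0.
  have [N1 h1] := Ylim z e e0; have [N2 h2] := Ylim (Y z) e e0.
  pose n := maxn N1 N2; have {}h2 := h2 n (leq_maxr _ _).
  have h3 := h1 _ (leq_trans (leq_maxl N1 N2) (leqnSn _)).
  have {}h1 := h1 n (leq_maxl _ _); rewrite -/n /= in h3.
  have -> : Y z - cplx 2^-1 *: (z - f z + Y (Y z)) =
      (Y z - cplx 2^-1 *: (z - f z + y n (y n z)))
    - cplx 2^-1 *: ((Y (Y z) - y n (Y z)) + y n (Y z - y n z)).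
    rewrite (aadjD (sqrt_iter_herm n)) (aadjN (sqrt_iter_herm n)).
    by lin.
  rewrite (le_trans (nrmB _ _))// nrmZr ger0_norm ?invr_ge0//.
  have := nrmD (Y (Y z) - y n (Y z)) (y n (Y z - y n z)).
  have := sqrt_iter_bnd n (Y z - y n z); have /andP[_ q1] := sqrt_bound01 n.
  by have := ler_wpM2r (nrm_ge0 (Y z - y n z)) q1; lra.
exists (fun z => z - Y z); split.
- by move=> z w; rewrite aipDl aipDr aipNl aipNr Yherm.
- move=> z; rewrite (aadjD Yherm) (aadjN Yherm).
  have := YY z; set u := Y (Y z); set v := Y z => vE.
  have -> : z - v - (v - u) = z - cplx 2 *: v + u by lin.
  rewrite vE scalerA -rmorphM /= mulfV// scale1r; lin.
- by move=> z; rewrite opprB addrC subrK.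
- move=> g hg [M M0 gM] fg z; rewrite (aadjD hg) (aadjN hg); congr (_ - _).
  apply: (@nrm_small_eq _ _ _ _ (1 + M)) => e e0.
  have [N1 h1] := Ylim z e e0.
  have [N2 h2] := Ylim (g z) e e0.
  pose n := maxn N1 N2; have {}h1 := h1 n (leq_maxl _ _).
  have {}h2 := h2 n (leq_maxr _ _).
  have -> : Y (g z) - g (Y z) = (Y (g z) - y n (g z)) - g (Y z - y n z).
    by rewrite (aadjD hg) (aadjN hg) (sqrt_iter_comm n hg fg); lin.
  rewrite (le_trans (nrmB _ _))//.
  have := gM (Y z - y n z); have := ler_wpM2l (ltW M0) (ltW h1); lra.
Qed.

End Iteration.

(** Dividing by [c] brings [f] within distance 1 of the identity, where the iteration converges; the
    root is then multiplied by the square root of [c]. *)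
Lemma positive_sqrt f : positive_op f -> exists r, [/\ positive_op r,
  forall z, r (r z) = f z
  & forall g, herm g -> bnd g -> fcomm f g -> fcomm r g].
Proof.
move=> [hf [c c0 fc]]; pose f1 z := cplx c^-1 *: f z.
have hf1 : herm f1 by move=> z w; rewrite aipZl aipZr conjc_real hf.
have cc : c^-1 * c = 1 by rewrite mulVf// gt_eqF.
have [z|r [hr rr r1 rg]] := sqrt_contraction hf1.
  have -> : z - f1 z = cplx c^-1 *: (cplx c *: z - f z).
    by rewrite scalerBr scalerA -rmorphM /= cc scale1r.
  rewrite nrmZr ger0_norm ?invr_ge0 ?(ltW c0)//.
  by rewrite -[leRHS]mul1r -cc -mulrA ler_wpM2l// invr_ge0 ltW.
pose k := Num.sqrt c; have k0 : 0 < k by rewrite sqrtr_gt0.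
have kk : k * k = c by rewrite -expr2 sqr_sqrtr// ltW.
exists (fun z => cplx k *: r z); split.
- apply: positive_scale => //; split=> //.
  by exists 1 => // z; rewrite scale1r mul1r.
- move=> z; rewrite (aadjZ hr) scalerA -rmorphM /= kk rr.
  rewrite /f1 scalerA -rmorphM /=.
  by rewrite mulrC cc scale1r.
- move=> g hg bg fg z; rewrite (aadjZ hg) rg// => w.
  by rewrite /f1 (aadjZ hg) fg.
Qed.

End SquareRoot.

(** * The cone of positive operators and its order *)

Section Cone.
Variables (R : realType) (A : cstarAlgType R).
Implicit Types (a b x y z w : A) (f g h r s : A -> A).

(* [r + i s] is [sqrt d] times an isometry, and so is its adjoint [r - i s]. *)
Lemma herm_sqr_sum_bound r s (d : R) : herm r -> herm s -> fcomm r s ->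
  (forall z, r (r z) + s (s z) = cplx d *: z) -> 0 <= d ->
  forall z, nrm (r z) <= Num.sqrt d * nrm z.
Proof.
move=> hr hs rs rsd d0 z.
have iso (k : R[i]) : k = 'i%C \/ k = - 'i%C ->
    nrm (r z + k *: s z) = Num.sqrt d * nrm z.
  move=> kE; have kk : conjc k * k = 1.
    have := sqr_i R; rewrite expr2 => ii.
    case: kE => ->; first by rewrite conj_i mulNr ii opprK.
    by rewrite conj_Ni mulrN ii opprK.
  have kN : conjc k = - k.
    by case: kE => ->; rewrite ?conj_i ?conj_Ni ?opprK.
  have h : aip (r z + k *: s z) (r z + k *: s z) = cplx d *: aip z z.
    have -> : cplx d *: aip z z = aip z (r (r z)) + aip z (s (s z)).
      by rewrite -aipDr rsd aipZr.
    rewrite !(aipDl, aipDr, aipZl, aipZr) !hr !hs rs !scalerA ?[k * _]mulrC kk.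
    by rewrite kN; linear_coefs R[i]; ring.
  apply/eqP; rewrite -(@eqrXn2 _ 2)// ?nrm_ge0 ?mulr_ge0 ?sqrtr_ge0 ?nrm_ge0//.
  by rewrite -nrm_aip_id h nrmZr ger0_norm// exprMn sqr_sqrtr// nrm_aip_id.
have -> : r z = cplx 2^-1 *: ((r z + 'i%C *: s z) + (r z + (- 'i%C) *: s z)).
  have : (2 : R)^-1 * 2 = 1 by rewrite mulVf.
  move=> /(congr1 (@real_complex_def R (Phant R))); rewrite rmorphM rmorph1 /=.
  by rewrite rmorph_nat => h; linear_coefs R[i]; ring: h.
rewrite nrmZr ger0_norm ?invr_ge0//.
have := nrmD (r z + 'i%C *: s z) (r z + (- 'i%C) *: s z).
by rewrite !iso; [lra|right|left].
Qed.

(** Since [g = d - f] commutes with [f], so do the square roots [r] and [s]; now [r^2 + s^2 = d]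
    bounds [r], hence [f = r^2]. *)
Lemma positive_le_bound f g (d : R) : positive_op f -> positive_op g ->
  (forall z, f z + g z = cplx d *: z) -> 0 <= d ->
  forall z, nrm (f z) <= d * nrm z.
Proof.
move=> pf pg fg d0 z.
have [r [pr rr rC]] := positive_sqrt pf.
have [s [ps ss sC]] := positive_sqrt pg.
have [hf hg] := (positive_herm pf, positive_herm pg).
have [hr hs] := (positive_herm pr, positive_herm ps).
have fgC : fcomm f g.
  move=> w; have gE u : g u = cplx d *: u - f u by rewrite -fg addrC addKr.
  by rewrite !gE (aadjD hf) (aadjZ hf) (aadjN hf).
have rs : fcomm r s.
  apply: rC => //; first exact: positive_bnd.
  move=> w; apply/esym; apply: sC => //; first exact: positive_bnd.
have rB := @herm_sqr_sum_bound r s d hr hs rs _ d0.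
have {}rB w : nrm (r w) <= Num.sqrt d * nrm w.
  by apply: rB => u; rewrite rr ss fg.
rewrite -rr (le_trans (rB _))// -{2}(sqr_sqrtr d0) expr2 -mulrA.
by rewrite ler_wpM2l// sqrtr_ge0.
Qed.

Lemma positive_complement f (d : R) : 0 < d -> herm f ->
  (forall z, nrm (f z) <= d * nrm z) ->
  positive_op (fun z => cplx d *: z - f z).
Proof.
move=> d0 hf fd; split.
  by move=> z w; rewrite aipDl aipDr aipNl aipNr hf aipZl aipZr conjc_real.
by exists d => // z; rewrite subKr.
Qed.

(** If [|f| <= c], then [c^2 - f^2] has a root [v] commuting with [f]. From [v^2 + f^2 = c^2]
    follows [|v| <= c], so [|c^2 - f^2| <= c^2]. *)
Lemma positive_sqr f : herm f -> bnd f -> positive_op (fun z => f (f z)).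
Proof.
move=> hf [c c0 fc]; have c20 : 0 < c ^+ 2 by rewrite exprn_gt0.
have hff : herm (fun z => f (f z)) by move=> z w; rewrite !hf.
have ffc z : nrm (f (f z)) <= c ^+ 2 * nrm z.
  by rewrite (le_trans (fc _))// expr2 -mulrA ler_wpM2l// ltW.
have pg := positive_complement c20 hff ffc.
have [v [pv vv vC]] := positive_sqrt pg; have hv := positive_herm pv.
have vf : fcomm v f.
  apply: vC => // [|z]; first by exists c.
  by rewrite (aadjD hf) (aadjN hf) (aadjZ hf).
split=> //; exists (c ^+ 2) => // z; rewrite -vv.
have vB w : nrm (v w) <= Num.sqrt (c ^+ 2) * nrm w.
  by apply: (@herm_sqr_sum_bound v f) => // [u|]; [rewrite vv subrK|exact: ltW].
rewrite sqrtr_sqr gtr0_norm// in vB.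
by rewrite (le_trans (vB _))// expr2 -mulrA ler_wpM2l// ltW.
Qed.

(** The complement [d - (f + g)] is positive, so [f] and [g + (d - f - g)] are positive with sum
    [d]. *)
Lemma positive_mono f g (d : R) : positive_op f -> positive_op g -> 0 < d ->
  (forall z, nrm (f z + g z) <= d * nrm z) ->
  forall z, nrm (f z) <= d * nrm z.
Proof.
move=> pf pg d0 fgd.
have pfg := positive_add pf pg.
have pc := positive_complement d0 (positive_herm pfg) fgd.
apply: (positive_le_bound pf (positive_add pg pc)) (ltW d0) => z; lin.
Qed.

Lemma herm_eq0 f : herm f -> (forall z, f (f z) = 0) -> forall z, f z = 0.
Proof.
move=> hf ff z; apply/nrm_eq0/eqP; rewrite -sqrf_eq0 -nrm_aip_id hf ff.
by rewrite /aip cmulr0 nrm0.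
Qed.

(** Put [K = g^2]. The hypothesis turns a bound [B] of [K] into [K (c + 2 K)^2 <= c^2 B], which
    improves [B]; iterating this would drive the bound to 0, and the infimum of all bounds does it
    at once. *)
Lemma expansive_herm_eq0 g (c : R) : herm g -> bnd g -> 0 < c ->
  (forall z, nrm (g (cplx c *: z + cplx 2 *: g (g z))) <= c * nrm (g z)) ->
  forall z, g z = 0.
Proof.
move=> hg bg c0 gc; apply: herm_eq0 => //.
have gD := aadjD hg; have gZ := aadjZ hg; have gN := aadjN hg.
pose S := [set B : R | 0 < B /\ forall z, nrm (g (g z)) <= B * nrm z].
(* Expanding gives [c^2 K + 4 c K^2 + 4 K^3 <= c^2 B]. Dropping [K^3] and using
   [K^2 >= 2 mu K - mu^2] leaves [c (c + 8 mu) K <= c (c B + 4 mu^2)]. *)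
have Sstep B mu : S B -> 0 < mu -> S ((c * B + 4 * mu ^+ 2) / (c + 8 * mu)).
  move=> [B0 gB] mu0.
  have den0 : 0 < c + 8 * mu by rewrite addr_gt0// mulr_gt0.
  have num0 : 0 < c * B + 4 * mu ^+ 2.
    by rewrite addr_gt0// mulr_gt0// exprn_gt0.
  split=> [|z]; first by rewrite divr_gt0.
  pose Q z := g (cplx c *: z + cplx 2 *: g (g z)).
  have QE w : Q w = cplx c *: g w + cplx 2 *: g (g (g w)) by rewrite /Q gD !gZ.
  have hQ : herm Q.
    by move=> u w; rewrite !QE !(aipDl, aipDr, aipZl, aipZr) !conjc_real !hg.
  have gsq w : nrm (g w) ^+ 2 <= B * nrm w ^+ 2.
    rewrite -nrm_aip_id hg (le_trans (nrm_aip _ _))//.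
    by have := ler_wpM2l (nrm_ge0 w) (gB w); lra.
  have Qsq w : nrm (Q w) ^+ 2 <= c ^+ 2 * (B * nrm w ^+ 2).
    rewrite (@le_trans _ _ ((c * nrm (g w)) ^+ 2))//.
      have h0 : 0 <= c * nrm (g w) by rewrite mulr_ge0 ?nrm_ge0// ltW.
      by rewrite ler_pXn2r ?nnegrE ?nrm_ge0//; exact: gc.
    by rewrite exprMn ler_wpM2l// sqr_ge0.
  pose k := Num.sqrt (c ^+ 2 * B).
  have k20 : 0 < c ^+ 2 * B by rewrite mulr_gt0// exprn_gt0.
  have Qk w : nrm (Q w) <= k * nrm w.
    have h0 : 0 <= k * nrm w by rewrite mulr_ge0 ?nrm_ge0 ?sqrtr_ge0.
    rewrite -(@ler_pXn2r _ 2) ?nnegrE ?nrm_ge0//.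
    by rewrite exprMn sqr_sqrtr ?(ltW k20)// -mulrA.
  have QQ w : nrm (Q (Q w)) <= c ^+ 2 * B * nrm w.
    rewrite (le_trans (Qk _))// -(sqr_sqrtr (ltW k20)) -/k expr2 -mulrA.
    by rewrite ler_wpM2l ?sqrtr_ge0.
  have hQQ : herm (fun z => Q (Q z)) by move=> u w; rewrite !hQ.
  have p1 := positive_complement k20 hQQ QQ.
  pose K z := g (g z); have hK : herm K by move=> u w; rewrite /K !hg.
  have bK : bnd K by exact: bnd_comp.
  have p2 : positive_op (fun z => g (K (g (K z)))).
    apply: (@positive_ext _ _ (fun z => g (g (g (g (g (g z))))))) => // .
    have hg3 : herm (fun z => g (g (g z))) by move=> u w; rewrite !hg.
    by apply: (positive_sqr hg3); apply: (bnd_comp bg bK).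
  have p3 := positive_sqr
    (herm_lin (f := K) (g := id) 1 (- mu) hK (@herm_id _ _))
    (bnd_lin 1 (- mu) bK (@bnd_id _ _)).
  have pK : positive_op K by exact: positive_sqr.
  have c80 : 0 < c * (c + 8 * mu) by rewrite mulr_gt0.
  have num0' : 0 <= c * (c * B + 4 * mu ^+ 2) by rewrite mulr_ge0// ltW.
  have p4 : 0 < (4 : R) by [].
  have p4c : 0 < 4 * c by rewrite mulr_gt0.
  (* The sum [(c^2 B - Q^2) + 4 K^3 + 4 c (K - mu)^2] is exactly what is missing from
     [c (c + 8 mu) K] to the scalar [c (c B + 4 mu^2)]. *)
  have pR := positive_add p1 (positive_add (positive_scale p4 p2)
    (positive_scale p4c p3)).
  have := positive_le_bound (positive_scale c80 pK) pR.
  move=> /(_ (c * (c * B + 4 * mu ^+ 2)) _ num0' z) h.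
  rewrite nrmZr gtr0_norm// in h.
  rewrite mulrAC ler_pdivlMr// -(ler_pM2l c0).
  have {}h : c * (c + 8 * mu) * nrm (g (g z))
      <= c * (c * B + 4 * mu ^+ 2) * nrm z.
    by apply: h => w; rewrite !QE /K !(gD, gZ, gN); lin.
  by move: h; nra.
have [B1 [B10 gB1]] : exists B, S B.
  have [M M0 gM] := bg; exists (M * M); split; first exact: mulr_gt0.
  by move=> z; rewrite (le_trans (gM _))// -mulrA ler_wpM2l// ltW.
have SB1 : S B1 by [].
have infS : has_inf S by split; [exists B1|exists 0 => B [/ltW]].
pose B0 := inf S.
have B0_ge0 : 0 <= B0 by apply: lb_le_inf; [exists B1|move=> B [/ltW]].
have B0_eq0 : B0 = 0.
  apply/eqP; rewrite eq_le B0_ge0 andbT leNgt; apply/negP => B0_gt0.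
  (* For [mu = B0] and [c B < c B0 + B0^2] the improved bound gives [c B0 + 8 B0^2 < c B0 + 5 B0^2],
     a contradiction. *)
  have d0 : 0 < B0 ^+ 2 / c by rewrite divr_gt0// exprn_gt0.
  have [B SB Bd] := inf_adherent d0 infS.
  have := ge_inf (proj2 infS) (Sstep B B0 SB B0_gt0).
  rewrite -/B0 ler_pdivlMr; last by rewrite addr_gt0// mulr_gt0.
  have := Bd; rewrite -/B0 -(ltr_pM2l c0) mulrDr mulrCA mulfV ?gt_eqF// mulr1.
  by have := mulr_gt0 B0_gt0 B0_gt0; rewrite expr2; nra.
move=> z; apply: (@nrm_small_eq _ _ _ _ (nrm z)) => e e0; rewrite subr0 mulrC.
have [B [_ SB] Bd] := inf_adherent e0 infS.
rewrite (le_trans (SB z))// ler_wpM2r ?nrm_ge0// ltW// (lt_le_trans Bd)//.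
by rewrite -/B0 B0_eq0 add0r.
Qed.

End Cone.

(** * Positivity of [a^* a] and monotonicity of the norm *)

Section KelleyVaught.
Variables (R : realType) (A : cstarAlgType R).
Implicit Types (a b x y z w : A).

Lemma bnd_cmul a : bnd (cmul a).
Proof.
exists (nrm a + 1) => [|z]; first by rewrite ltr_wpDl ?nrm_ge0.
by rewrite (le_trans (nrm_cmul _ _))// ler_wpM2r ?nrm_ge0// lerDl.
Qed.

Lemma bnd_add (f g : A -> A) : bnd f -> bnd g -> bnd (fun z => f z + g z).
Proof.
move=> bf bg; have := bnd_lin 1 1 bf bg.
by congr bnd; apply/funext => z; rewrite !scale1r.
Qed.

Lemma bnd_scale (k : R[i]) (f : A -> A) : bnd f -> bnd (fun z => k *: f z).
Proof.
move=> [M M0 fM]; exists ((complex.Re `|k| + 1) * M) => [|z].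
  by rewrite mulr_gt0// ltr_wpDl// -ler0c RRe_real ?normr_real.
rewrite nrmZ -mulrA; have k0 : 0 <= complex.Re `|k|.
  by rewrite -ler0c RRe_real ?normr_real.
by rewrite ler_pM ?nrm_ge0// lerDl.
Qed.

(* Let [h] be multiplication by [a^* a], [p = |h| - h] and [r] the square root
   of [|h|].  The operator [X z = a (p z)] and its adjoint [X'] satisfy
   [X' X = - (r p)^2].  But [X X' + X' X] is positive, being half the sum of the
   squares of [X + X'] and [i (X - X')], hence so is [X X'], and this forces
   [r p = 0]. *)
Lemma positive_cstar_cmul a : positive_op (cmul (cmul (cstar a) a)).
Proof.
pose h z := cmul (cstar a) (cmul a z).
suff : positive_op h by apply: positive_ext => z; rewrite /h cmulA.
have ha : aadj (cmul a) (cmul (cstar a)).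
  by move=> z w; rewrite /aip cstarM cmulA.
have hh : herm h by move=> z w; rewrite /h (aadj_sym ha) ha.
have bh : bnd h by exact: (bnd_comp (bnd_cmul (cstar a)) (bnd_cmul a)).
have [m [pm mm mC]] := positive_sqrt (positive_sqr hh bh).
have [hm bm] := (positive_herm pm, positive_bnd pm).
have mh : fcomm m h by exact: mC.
have [r [pr rr rC]] := positive_sqrt pm.
have [hr br] := (positive_herm pr, positive_bnd pr).
have [rh rm] : fcomm r h /\ fcomm r m by split; exact: rC.
pose p z := m z - h z.
have hp : herm p by move=> z w; rewrite aipDl aipDr aipNl aipNr hm hh.
have bp : bnd p.
  have := bnd_lin 1 (- 1) bm bh; congr bnd; apply/funext => z.
  by rewrite scale1r rmorphN1 scaleN1r.
have [mD mN] := (aadjD hm, aadjN hm); have [pD pN] := (aadjD hp, aadjN hp).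
have [hD hN] := (aadjD hh, aadjN hh).
have rp : fcomm r p by move=> z; rewrite (aadjD hr) (aadjN hr) rm rh.
have hpE z : h (p z) = - m (p z).
  by rewrite hD hN mD mN -mm mh opprB addrC.
pose g z := r (p z).
have hg : herm g by exact: herm_comp.
have bg : bnd g by exact: bnd_comp.
pose X z := cmul a (p z); pose X' z := p (cmul (cstar a) z).
have XX' : aadj X X' by move=> z w; rewrite ha hp.
have X'XE z : X' (X z) = - g (g z).
  by rewrite /X' /X -/(h (p z)) hpE pN /g rp !rr -[m (p z)]rr -!rp rr.
have [XD X'D] := (aadjD XX', aadjD (aadj_sym XX')).
have [XN X'N] := (aadjN XX', aadjN (aadj_sym XX')).
have [XZ X'Z] := (aadjZ XX', aadjZ (aadj_sym XX')).
have bX : bnd X by exact: (bnd_comp (bnd_cmul a) bp).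
have bX' : bnd X' by exact: (bnd_comp bp (bnd_cmul (cstar a))).
pose U z := X z + X' z; pose W z := 'i%C *: (X z - X' z).
have hU : herm U.
  by move=> z w; rewrite aipDl aipDr XX' (aadj_sym XX') addrC.
have hW : herm W.
  move=> z w; rewrite aipZl aipZr conj_i aipDl aipNl aipDr aipNr.
  by rewrite XX' (aadj_sym XX'); lin.
have bW : bnd W.
  apply: bnd_scale; apply: bnd_add => //.
  have := bnd_scale (-1) bX'; congr bnd; apply/funext => z.
  by rewrite scaleN1r.
have pU := positive_sqr hU (bnd_add bX bX').
have pW := positive_sqr hW bW.
have pg := positive_scale (ltr0n _ 2) (positive_sqr hg bg).
have [_ [c c0 Xc]] := positive_add pU (positive_add pW pg).
(* The squares of [U] and [W] add up to [2 X X' + 2 X' X], and [2 g^2] cancels [2 X' X]. *)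
have Xpos z : nrm (cplx c *: z - cplx 2 *: X (X' z)) <= c * nrm z.
  apply: le_trans (Xc z); rewrite le_eqVlt; apply/orP; left; apply/eqP.
  congr nrm; congr (_ - _); rewrite /U /W.
  rewrite !(XD, X'D, XN, X'N, XZ, X'Z) X'XE.
  by linear_coefs R[i]; ring: (sqr_i R).
have nXg z : nrm (X z) = nrm (g z).
  apply/eqP; rewrite -(@eqrXn2 _ 2)// ?nrm_ge0//.
  by rewrite -!nrm_aip_id XX' X'XE hg aipNr nrmN.
have g0 : forall z, g z = 0.
  (* [Xpos] at [X z] reads [|X (c z + 2 g^2 z)| <= c |X z|], and [|X w| = |g w|] for every [w]. *)
  apply: (@expansive_herm_eq0 _ _ g c) => // z.
  rewrite -!nXg XD !XZ; have := Xpos (X z).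
  by rewrite X'XE XN scalerN opprK.
have mp0 z : m (p z) = 0 by rewrite -rr -/(g z) g0 (aadj0 hr).
have p0 : forall z, p z = 0.
  by apply: herm_eq0 => // z; rewrite {1}/p mp0 hpE mp0 oppr0 subr0.
by apply: positive_ext pm => z; apply/eqP; rewrite -subr_eq0 -/(p z) p0.
Qed.

Lemma cpositive_op a : cpositive a -> positive_op (cmul a).
Proof.
move=> [s ->]; elim: s => [|b s IH].
  rewrite big_nil; apply: positive_ext (positive0 A) => z.
  by rewrite cmul0r.
rewrite big_cons; apply: positive_ext (positive_add (positive_cstar_cmul b) IH).
by move=> z; rewrite cmulDl.
Qed.

Lemma cpositive_star a : cpositive a -> cstar a = a.
Proof.
move=> [s ->]; elim: s => [|b s IH]; first by rewrite !big_nil cstar0.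
by rewrite big_cons cstarD IH cstarM cstarK.
Qed.

(** The operator bound for multiplication by [a], evaluated at [a] itself, gives
    [|a|^2 <= (|a + b| + e) |a|]; the slack [e] keeps the constant positive. *)
Lemma cpositive_mono a b : cpositive a -> cpositive b -> nrm a <= nrm (a + b).
Proof.
move=> pa pb; apply/ler_addgt0Pr => e e0.
have d0 : 0 < nrm (a + b) + e by rewrite ltr_wpDl ?nrm_ge0.
have h := positive_mono (cpositive_op pa) (cpositive_op pb) d0.
have {h} /(_ a) : forall z, nrm (cmul a z) <= (nrm (a + b) + e) * nrm z.
  apply: h => z; rewrite -cmulDl (le_trans (nrm_cmul _ _))//.
  by rewrite ler_wpM2r ?nrm_ge0// lerDl ltW.
rewrite -{1}(cpositive_star pa) nrm_cstar_mul expr2.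
have := nrm_ge0 a; rewrite le_eqVlt => /orP[/eqP <-|a0].
  by move=> _; exact: ltW.
by rewrite ler_pM2r.
Qed.

End KelleyVaught.

(** * Adjointable and compact operators *)

Section SemiInner.
Variables (R : realType) (A : cstarAlgType R) (F : semiInnerModType A).
Implicit Types x y z : F.

Lemma innerDl x y z : inner (x + y) z = inner x z + inner y z.
Proof. by rewrite -inner_star innerDr cstarD !inner_star. Qed.

Lemma innerZl (k : R[i]) x y : inner (k *: x) y = conjc k *: inner x y.
Proof. by rewrite -inner_star innerZr cstarZ inner_star. Qed.

Lemma innerNr x y : inner x (- y) = - inner x y.
Proof. by rewrite -scaleN1r innerZr scaleN1r. Qed.

Lemma innerNl x y : inner (- x) y = - inner x y.
Proof. by rewrite -inner_star innerNr cstarN inner_star. Qed.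

Lemma inner0r x : inner x 0 = 0.
Proof. by rewrite -(subrr x) innerDr innerNr subrr. Qed.

Lemma inner0l x : inner 0 x = 0.
Proof. by rewrite -(subrr x) innerDl innerNl subrr. Qed.

Lemma inner_suml (I : Type) (s : seq I) (f : I -> F) y :
  inner (\sum_(i <- s) f i) y = \sum_(i <- s) inner (f i) y.
Proof.
by elim/big_rec2: _ => [|i a b _ <-]; rewrite ?inner0l// innerDl.
Qed.

Lemma inner_sumr (I : Type) (s : seq I) (f : I -> F) y :
  inner y (\sum_(i <- s) f i) = \sum_(i <- s) inner y (f i).
Proof.
by elim/big_rec2: _ => [|i a b _ <-]; rewrite ?inner0r// innerDr.
Qed.

Lemma inner_mactl x y a : inner (mact x a) y = cmul (cstar a) (inner x y).
Proof. by rewrite -inner_star inner_mact cstarM inner_star. Qed.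

Lemma hnormE x : hnorm x = Num.sqrt (nrm (inner x x)).
Proof. by []. Qed.

Lemma hnorm_ge0 x : 0 <= hnorm x.
Proof. exact: sqrtr_ge0. Qed.

Lemma hnorm_sqr x : hnorm x ^+ 2 = nrm (inner x x).
Proof. by rewrite hnormE sqr_sqrtr// nrm_ge0. Qed.

End SemiInner.

Section Hilbert.
Variables (R : realType) (A : cstarAlgType R) (E : hilbertModType A).
Implicit Types (x y z : E) (f g : E -> E) (S T G : adjOp E E).

Lemma hnorm_nrm x : hnorm x = nrm x.
Proof. by rewrite /nrm norm_hnorm. Qed.

Lemma nrm_inner_id x : nrm (inner x x) = nrm x ^+ 2.
Proof. by rewrite -hnorm_nrm hnorm_sqr. Qed.

(* The constant 4 comes from polarization, which derives the bound from the
   triangle inequality for the norm of [E]; its value is immaterial. *)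
Lemma nrm_inner x y : nrm (inner x y) <= 4 * (nrm x * nrm y).
Proof.
have polar (u v : E) : nrm (inner u v) <= (nrm u + nrm v) ^+ 2.
  pose q k := inner (u + k *: v) (u + k *: v).
  have qb k : complex.Re `|k| = 1 -> nrm (q k) <= (nrm u + nrm v) ^+ 2.
    move=> k1; rewrite /q nrm_inner_id ler_pXn2r ?nnegrE ?addr_ge0 ?nrm_ge0//.
    by rewrite (le_trans (nrmD _ _))// nrmZ k1 mul1r.
  have i1 : complex.Re `|'i%C : R[i]| = 1.
    by rewrite normc_def /= expr0n /= add0r expr1n sqrtr1.
  have -> : inner u v = cplx 4^-1 *: (q 1 - q (-1)
      + (- 'i%C) *: (q 'i%C - q (- 'i%C))).
    rewrite /q !(innerDl, innerDr, innerZl, innerZr) conj_i conj_Ni.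
    rewrite rmorphN rmorph1.
    have h4 : cplx (4^-1 : R) * 4 = 1.
      by rewrite -(rmorph_nat (@real_complex_def R (Phant R))) -rmorphM mulVf.
    by linear_coefs R[i]; ring: h4 (sqr_i R).
  rewrite nrmZr ger0_norm ?invr_ge0//.
  have h1 := qb 1; have h2 := qb (-1); have h3 := qb 'i%C.
  have h4 := qb (- 'i%C).
  rewrite normrN1 normr1 !normrN in h1 h2 h4.
  have {}h1 := h1 erefl; have {}h2 := h2 erefl; have {}h3 := h3 i1.
  have {}h4 := h4 i1.
  have := nrmD (q 1 - q (-1)) ((- 'i%C) *: (q 'i%C - q (- 'i%C))).
  rewrite scaleNr nrmN nrmZi.
  have := nrmB (q 1) (q (-1)); have := nrmB (q 'i%C) (q (- 'i%C)); lra.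
have := nrm_ge0 x; rewrite le_eqVlt => /orP[/eqP/esym/nrm_eq0 ->|x0].
  by rewrite inner0l !nrm0 mul0r mulr0.
have := nrm_ge0 y; rewrite le_eqVlt => /orP[/eqP/esym/nrm_eq0 ->|y0].
  by rewrite inner0r !nrm0 !mulr0.
have := polar (cplx (nrm x)^-1 *: x) (cplx (nrm y)^-1 *: y).
rewrite innerZl innerZr conjc_real !nrmZr !ger0_norm ?invr_ge0 ?nrm_ge0//.
rewrite !mulVf ?gt_eqF// mulrA -invfM mulrC ler_pdivrMr ?mulr_gt0//.
have -> : ((1 : R) + 1) ^+ 2 = 4 by ring.
by [].
Qed.

Lemma inner_inj x y : (forall z, inner z x = inner z y) -> x = y.
Proof.
move=> h; apply/eqP; rewrite -subr_eq0; apply/eqP/nrm_eq0/eqP.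
by rewrite -sqrf_eq0 -nrm_inner_id innerDr innerNr h subrr nrm0.
Qed.

Definition hadj f g := forall x y, inner (f x) y = inner x (g y).

Lemma hadj_sym f g : hadj f g -> hadj g f.
Proof. by move=> fg x y; rewrite -inner_star -fg inner_star. Qed.

(** Cauchy-Schwarz followed by division by [|u|]. With [w = f u] and [u] the adjoint of [f] at [v],
    it bounds an adjoint by the operator. *)
Lemma inner_le_bound (u v w : E) (M : R) : 0 <= M ->
  inner u u = inner w v -> nrm w <= M * nrm u -> nrm u <= 4 * M * nrm v.
Proof.
move=> M0 uE wM; have := nrm_ge0 u; rewrite le_eqVlt => /orP[/eqP <-|u0].
  by rewrite !mulr_ge0 ?nrm_ge0.
rewrite -(ler_pM2r u0) -expr2 -nrm_inner_id uE (le_trans (nrm_inner _ _))//.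
have := ler_wpM2r (nrm_ge0 v) wM; lra.
Qed.

Lemma adjOp_bound T : exists2 M : R, 0 < M & forall x, nrm (T x) <= M * nrm x.
Proof.
have [M TM] := adjOp_bounded T; exists (`|M| + 1) => [|x].
  by rewrite ltr_wpDl.
have := TM x; rewrite !hnorm_nrm => /le_trans; apply.
by rewrite ler_wpM2r ?nrm_ge0// (le_trans (ler_norm _))// lerDl.
Qed.

Lemma adjOp_exists f g (M : R) : hadj f g ->
  (forall x, nrm (f x) <= M * nrm x) -> exists T, adjOp_fun T = f.
Proof.
move=> fg fM; have gf := hadj_sym fg.
have fD x y : f (x + y) = f x + f y.
  by apply: inner_inj => z; rewrite innerDr -!gf innerDr.
have fZ (k : R[i]) x : f (k *: x) = k *: f x.
  by apply: inner_inj => z; rewrite innerZr -!gf innerZr.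
have fa a x : f (mact x a) = mact (f x) a.
  by apply: inner_inj => z; rewrite inner_mact -!gf inner_mact.
have fb : exists M : R, forall x, hnorm (f x) <= M * hnorm x.
  by exists M => x; rewrite !hnorm_nrm.
by exists (AdjOp fD fZ fa fb (ex_intro _ g fg)).
Qed.

Lemma adjOp_adj T (M : R) : 0 <= M -> (forall x, nrm (T x) <= M * nrm x) ->
  exists T', hadj T T' /\ forall x, nrm (T' x) <= 4 * M * nrm x.
Proof.
move=> M0 TM; have [g Tg] := adjOp_adjointable T.
have gM y : nrm (g y) <= 4 * M * nrm y.
  by apply: (inner_le_bound M0 (w := T (g y))); rewrite ?Tg.
by have [T' T'E] := adjOp_exists (hadj_sym Tg) gM; exists T'; rewrite T'E.
Qed.

Lemma adjOp_adjoint T : exists T', hadj T T'.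
Proof.
have [M M0 TM] := adjOp_bound T.
by have [T' [TT' _]] := adjOp_adj (ltW M0) TM; exists T'.
Qed.

Lemma adjOp_comp S T : exists U : adjOp E E, adjOp_fun U = fun x => S (T x).
Proof.
have [S' SS'] := adjOp_adjoint S; have [T' TT'] := adjOp_adjoint T.
have [M M0 SM] := adjOp_bound S; have [N N0 TN] := adjOp_bound T.
apply: (@adjOp_exists _ (fun x => T' (S' x)) (M * N)).
  by move=> x y; rewrite SS' TT'.
by move=> x; rewrite (le_trans (SM _))// -mulrA ler_wpM2l// ltW.
Qed.

Lemma adjOp_add S T : exists U : adjOp E E, adjOp_fun U = fun x => S x + T x.
Proof.
have [S' SS'] := adjOp_adjoint S; have [T' TT'] := adjOp_adjoint T.
have [M M0 SM] := adjOp_bound S; have [N N0 TN] := adjOp_bound T.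
apply: (@adjOp_exists _ (fun x => S' x + T' x) (M + N)).
  by move=> x y; rewrite innerDl innerDr SS' TT'.
by move=> x; rewrite (le_trans (nrmD _ _))// mulrDl lerD.
Qed.

Lemma adjOpN T x : T (- x) = - T x.
Proof. by rewrite -scaleN1r adjOpZ scaleN1r. Qed.

Lemma adjOpB T x y : T (x - y) = T x - T y.
Proof. by rewrite adjOpD adjOpN. Qed.

(* It suffices to know the adjoint on a dense set, as it is bounded there. *)
Lemma adjOp_of_dense f g (D : set E) (M : R) : 0 <= M ->
  (forall x, nrm (f x) <= M * nrm x) -> dense D ->
  (forall x y, D y -> inner (f x) y = inner x (g y)) ->
  exists T, adjOp_fun T = f.
Proof.
move=> M0 fM Dd fg.
have gM y y' : D y -> D y' -> nrm (g y - g y') <= 4 * M * nrm (y - y').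
  move=> Dy Dy'; apply: (inner_le_bound M0 (w := f (g y - g y'))) => //.
  by rewrite !(innerDr, innerNr) !fg// !(innerDr, innerNr).
have /boolp.choice[g' fg'] : forall y, exists l, forall x,
    inner (f x) y = inner x l.
  move=> y; have /boolp.choice[u uP] : forall n, exists u, D u /\
      nrm (y - u) < n.+1%:R^-1.
    move=> n; have n0 : 0 < (n.+1%:R^-1 : R) by rewrite invr_gt0.
    by have [u] := dense_nrm Dd y n0; exists u.
  have uy e : 0 < e -> exists N, forall i, (N <= i)%N -> nrm (y - u i) < e.
    move=> e0; exists (Num.trunc e^-1) => i; rewrite truncn_le_nat => ei.
    have [_ /lt_trans] := uP i; apply.
    by rewrite invf_plt ?posrE.
  have [|l ul] := @nrm_complete R E (fun i => g (u i)).
    (* Two terms within [d] of [y] differ by less than [2 d], so their images under [g] by at most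
       [8 M d < e]. *)
    move=> e e0; have d0 : 0 < e / (8 * M + 1).
      by rewrite divr_gt0// ltr_wpDl// mulr_ge0.
    have [N uN] := uy _ d0; exists N => i j Ni Nj.
    have [Di _] := uP i; have [Dj _] := uP j.
    rewrite (le_lt_trans (gM _ _ Di Dj))//.
    have := nrm_split y (u i) (u j); rewrite (nrmC _ y).
    move: d0 (uN i Ni) (uN j Nj); set d := e / _ => d0 h1 h2 h3.
    have dE : e = d * (8 * M + 1).
      by rewrite /d divfK// gt_eqF// ltr_wpDl// mulr_ge0.
    have : M * nrm (u i - u j) <= M * (d + d) by rewrite ler_wpM2l//; lra.
    by rewrite dE; nra.
  exists l => x; apply: (@nrm_small_eq _ _ _ _ (4 * (nrm (f x) + nrm x))).
  move=> e e0; have [N1 h1] := ul e e0; have [N2 h2] := uy e e0.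
  pose n := maxn N1 N2; have {}h1 := h1 n (leq_maxl _ _).
  have {}h2 := h2 n (leq_maxr _ _); have [Dn _] := uP n.
  have -> : inner (f x) y - inner x l
      = inner (f x) (y - u n) - inner x (l - g (u n)).
    by rewrite !(innerDr, innerNr) (fg x (u n) Dn); lin.
  rewrite (le_trans (nrmB _ _))//.
  have := nrm_inner (f x) (y - u n); have := nrm_inner x (l - g (u n)).
  have := ler_wpM2l (nrm_ge0 x) (ltW h1).
  by have := ler_wpM2l (nrm_ge0 (f x)) (ltW h2); lra.
by apply: (@adjOp_exists f g' M).
Qed.

(** Both [1 + T] and [1 + T'] are inverted by contraction, and the two inverses are adjoint to each
    other. The bound [1/8] is needed because [T'] is only known to be bounded by [4 r]. *)
Lemma one_plus_adjOp_inverse T (r : R) : 0 <= r -> r <= 8^-1 ->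
  (forall x, nrm (T x) <= r * nrm x) -> exists S, forall x, S x + T (S x) = x.
Proof.
move=> r0 r8 Tr; have [T' [TT' T'r]] := adjOp_adj r0 Tr.
have solve (Q : adjOp E E) : (forall x, nrm (Q x) <= 4 * r * nrm x) ->
    exists f, forall x, f x + Q (f x) = x.
  move=> Qr.
  suff /boolp.choice[f fP] : forall w, exists x, x + Q x = w by exists f.
  move=> w.
  have r41 : 4 * r < 1 by lra.
  have r40 : 0 <= 4 * r by lra.
  have [] := onto_perturb (@nrm_complete R E) (@nrm_ge0 R E) (nrm0 _)
    (@nrm_le0 R E) (@nrmD R E) (@nrmN R E) r40 r41
    (D := setT) (sub := fun x y => x - y) (P := id) (W := Q) _ _ _ w.
  - by move=> x y _ _; rewrite adjOpB.
  - by move=> v; exists v.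
  - by move=> x _; exact: Qr.
  - by move=> x _; exists x.
have [x|f fT] := solve T.
  by rewrite (le_trans (Tr x))// ler_wpM2r ?nrm_ge0//; lra.
have [g gT'] := solve T' T'r.
have fg : hadj f g.
  move=> x y; rewrite -{1}(gT' y) -{2}(fT x) innerDr innerDl; congr (_ + _).
  by rewrite TT'.
have [|S SE] := adjOp_exists fg (M := 2).
  move=> x; have := Tr (f x); have := nrmB x (T (f x)).
  rewrite -{1}(fT x) addrK; have := nrm_ge0 (f x).
  have := ler_wpM2r (nrm_ge0 (f x)) r8; lra.
by exists S => x; rewrite SE fT.
Qed.

Lemma compact_compr f T : compact_op f -> compact_op (fun x => f (T x)).
Proof.
move=> fc e e0; have [M M0 TM] := adjOp_bound T.
have [T' TT'] := adjOp_adjoint T.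
have [ps fps] := fc _ (divr_gt0 e0 M0).
exists [seq (p.1, T' p.2) | p <- ps] => z; rewrite big_map /=.
under eq_bigr do rewrite (hadj_sym TT').
rewrite (le_trans (fps _))// !hnorm_nrm.
have -> : e * nrm z = e / M * (M * nrm z) by rewrite mulrA divfK// gt_eqF.
by rewrite ler_wpM2l// ltW// divr_gt0.
Qed.

Lemma compact_add f g : compact_op f -> compact_op g ->
  compact_op (fun x => f x + g x).
Proof.
move=> fc gc e e0; have e20 : 0 < e / 2 by lra.
have [ps fps] := fc _ e20; have [qs gqs] := gc _ e20.
exists (ps ++ qs) => z; rewrite big_cat /= opprD addrACA.
have := fps z; have := gqs z; rewrite !hnorm_nrm => h1 h2.
by rewrite (le_trans (nrmD _ _))//; lra.
Qed.

(** The error [u] of the transposed finite rank operator at [y] satisfies [<u, u> = <w, y>] with [w]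
    the original error at [u]; [e / 4] absorbs the constant of [inner_le_bound]. *)
Lemma compact_adj f g : hadj f g -> compact_op f -> compact_op g.
Proof.
move=> fg fc e e0; have e40 : 0 < e / 4 by lra.
have [ps fps] := fc _ e40; exists [seq (p.2, p.1) | p <- ps] => y.
rewrite big_map /= !hnorm_nrm; set u := g y - _.
pose w := f u - \sum_(p <- ps) mact p.1 (inner p.2 u).
have -> : e = 4 * (e / 4) by field.
apply: (inner_le_bound (ltW e40) (w := w)); last first.
  by have := fps u; rewrite !hnorm_nrm.
rewrite {2}/u innerDr innerNr inner_sumr -fg /w innerDl innerNl inner_suml.
congr (_ - _); apply: eq_bigr => p _.
by rewrite inner_mact inner_mactl inner_star.
Qed.

End Hilbert.

(** * Regular operators and parametrices *)

Section Operators.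
Variables (R : realType) (A : cstarAlgType R) (E : hilbertModType A).
Implicit Types (x y z u v w : E) (t s : unbOp E E) (S T G : adjOp E E).

Lemma graphP t x y : graph t (x, y) <-> dom t x /\ t x = y.
Proof.
split=> [[u du [<- <-]]//|[dx <-]]; by exists x.
Qed.

Lemma unbOpN t x : dom t x -> t (- x) = - t x.
Proof. by move=> dx; rewrite -scaleN1r appZ// scaleN1r. Qed.

Lemma domN t x : dom t x -> dom t (- x).
Proof.
by move=> dx; have [_ _ dZ _] := dom_submodule t; rewrite -scaleN1r; exact: dZ.
Qed.

Lemma domD t x y : dom t x -> dom t y -> dom t (x + y).
Proof. by have [_ dD _ _] := dom_submodule t; exact: dD. Qed.

Lemma domZ t (k : R[i]) x : dom t x -> dom t (k *: x).
Proof. by have [_ _ dZ _] := dom_submodule t; exact: dZ. Qed.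

Lemma dom0 t : dom t 0.
Proof. by have [] := dom_submodule t. Qed.

Lemma domB t x y : dom t x -> dom t y ->
  dom t (x - y) /\ t (x - y) = t x - t y.
Proof.
move=> dx dy; have dy' := domN dy.
by rewrite appD// unbOpN//; split=> //; exact: domD.
Qed.

Lemma adjoint_graphD t y z y' z' : adjoint_graph t (y, z) ->
  adjoint_graph t (y', z') -> adjoint_graph t (y + y', z + z').
Proof. by move=> a a' x dx; rewrite /= !innerDr a// a'. Qed.

Lemma adjoint_graphN t y z : adjoint_graph t (y, z) ->
  adjoint_graph t (- y, - z).
Proof. by move=> a x dx; rewrite /= !innerNr a. Qed.

Lemma adjoint_graph_closed t y z :
  (forall e : R, 0 < e -> exists y' z',
    [/\ adjoint_graph t (y', z'), nrm (y - y') < e & nrm (z - z') < e]) ->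
  adjoint_graph t (y, z).
Proof.
move=> h x dx /=; apply: (@nrm_small_eq _ _ _ _ (4 * (nrm (t x) + nrm x))).
move=> e e0; have [y' [z' [a yy' zz']]] := h e e0.
have -> : inner (t x) y - inner x z
    = inner (t x) (y - y') - inner x (z - z').
  have axy : inner (t x) y' = inner x z' := a x dx.
  by rewrite !(innerDr, innerNr) axy; lin.
rewrite (le_trans (nrmB _ _))//.
have := nrm_inner (t x) (y - y'); have := nrm_inner x (z - z').
have := ler_wpM2l (nrm_ge0 x) (ltW zz').
by have := ler_wpM2l (nrm_ge0 (t x)) (ltW yy'); lra.
Qed.

Lemma closed_graph t x y : closed (graph t) ->
  (forall e : R, 0 < e -> exists u,
    [/\ dom t u, nrm (x - u) < e & nrm (y - t u) < e]) ->
  dom t x /\ t x = y.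
Proof.
move=> tc h; apply/graphP; apply: tc; apply/closure_nrm => e /h[u [du xu yu]].
by exists u, (t u); split=> //; apply/graphP.
Qed.

Lemma nrm_le_inner_add x (a : A) : cpositive a ->
  nrm x ^+ 2 <= nrm (inner x x + a).
Proof.
by move=> pa; rewrite -nrm_inner_id cpositive_mono//; exact: inner_ge0.
Qed.

(* [(u, v)] belongs to the sum of the graph of [t] and its orthogonal. *)
Definition graph_sum t u v := exists x y z,
  [/\ dom t x, adjoint_graph t (y, z), u = x + z & v = t x - y].

Lemma graph_sumD t u v u' v' : graph_sum t u v -> graph_sum t u' v' ->
  graph_sum t (u + u') (v + v').
Proof.
move=> [x [y [z [dx a -> ->]]]] [x' [y' [z' [dx' a' -> ->]]]].
exists (x + x'), (y + y'), (z + z'); split.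
- exact: domD.
- exact: adjoint_graphD.
- by rewrite addrACA.
- by rewrite appD// opprD addrACA.
Qed.

(** Pairing [(u, v) = (x, t x) + (z, - y)] with each of the two orthogonal summands bounds that
    summand. In [aux] the larger of the two coordinate norms is divided out. *)
Lemma graph_sum_bound t x y z : dom t x -> adjoint_graph t (y, z) ->
  nrm x <= 4 * (nrm (x + z) + nrm (t x - y)) /\
  nrm (t x) <= 4 * (nrm (x + z) + nrm (t x - y)) /\
  nrm y <= 4 * (nrm (x + z) + nrm (t x - y)).
Proof.
move=> dx a; set u := x + z; set v := t x - y.
have aux (p q : E) :
    inner p p + inner q q = inner p u + inner q v \/
    inner p p + inner q q = inner p u - inner q v ->
    nrm p <= 4 * (nrm u + nrm v) /\ nrm q <= 4 * (nrm u + nrm v).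
  move=> pq.
  have pqN : nrm (inner p p + inner q q) <= 4 * (nrm p * nrm u + nrm q * nrm v).
    by case: pq => ->;
      [apply: le_trans (nrmD _ _) _|apply: le_trans (nrmB _ _) _];
      have := nrm_inner p u; have := nrm_inner q v; lra.
  have p2 := le_trans (nrm_le_inner_add p (inner_ge0 q)) pqN.
  have := le_trans (nrm_le_inner_add q (inner_ge0 p)).
  rewrite addrC => /(_ _ pqN) q2; move: p2 q2.
  have := nrm_ge0 p; have := nrm_ge0 q; have := nrm_ge0 u; have := nrm_ge0 v.
  move: (nrm p) (nrm q) (nrm u) (nrm v) => a1 b1 c1 d1 d0 c0 b0 a0 h1 h2.
  have [ab|/ltW ba] := leP a1 b1.
    suff bb : b1 <= 4 * (c1 + d1) by split=> //; exact: le_trans bb.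
    rewrite leNgt; apply/negP => lt; have : b1 * b1 > b1 * (4 * (c1 + d1)).
      by rewrite ltr_pM2l// (le_lt_trans _ lt)// mulr_ge0// addr_ge0.
    have := ler_wpM2r c0 ab; move: h2; rewrite expr2; lra.
  suff bb : a1 <= 4 * (c1 + d1) by split=> //; exact: le_trans bb.
  rewrite leNgt; apply/negP => lt; have : a1 * a1 > a1 * (4 * (c1 + d1)).
    by rewrite ltr_pM2l// (le_lt_trans _ lt)// mulr_ge0// addr_ge0.
  have := ler_wpM2r d0 ba; move: h1; rewrite expr2; lra.
have axy : inner (t x) y = inner x z by exact: a.
have ayx : inner y (t x) = inner z x by rewrite -inner_star axy inner_star.
have [|h1 h2] := aux x (t x).
  by left; rewrite /u /v !(innerDr, innerNr) axy; lin.
have [|_ h3] := aux z y.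
  by right; rewrite /u /v !(innerDr, innerNr) ayx; lin.
by [].
Qed.

(** By [graph_sum_bound] the graph components of the approximations are Cauchy; closedness puts
    their limit in the graph, and the remainder is orthogonal by continuity. *)
Lemma graph_sum_closed t u v : closed (graph t) ->
  (forall e : R, 0 < e -> exists u' v',
    [/\ graph_sum t u' v', nrm (u - u') < e & nrm (v - v') < e]) ->
  graph_sum t u v.
Proof.
move=> tc h; have /boolp.choice[f fP] : forall n, exists p : E * E * E,
    [/\ dom t p.1.1, adjoint_graph t (p.1.2, p.2),
     nrm (u - (p.1.1 + p.2)) < n.+1%:R^-1
   & nrm (v - (t p.1.1 - p.1.2)) < n.+1%:R^-1].
  move=> n; have n0 : 0 < (n.+1%:R^-1 : R) by rewrite invr_gt0.
  have [u' [v' [[x [y [z [dx a -> ->]]]] hu hv]]] := h _ n0.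
  by exists (x, y, z).
have lim e : 0 < e -> exists N, forall i, (N <= i)%N ->
    nrm (u - ((f i).1.1 + (f i).2)) < e /\
    nrm (v - (t (f i).1.1 - (f i).1.2)) < e.
  move=> e0; exists (Num.trunc e^-1) => i; rewrite truncn_le_nat => ei.
  have ie : i.+1%:R^-1 < e by rewrite invf_plt ?posrE.
  by have [_ _ h1 h2] := fP i; split; exact: lt_trans ie.
have cau e : 0 < e -> exists N, forall i j, (N <= i)%N -> (N <= j)%N ->
    [/\ nrm ((f i).1.1 - (f j).1.1) < e, nrm (t (f i).1.1 - t (f j).1.1) < e
      & nrm ((f i).1.2 - (f j).1.2) < e].
  (* Four errors of size [e / 16], times the constant 4 of [graph_sum_bound]. *)
  move=> e0; have e10 : 0 < e / 16 by lra.
  have [N limN] := lim _ e10; exists N => i j Ni Nj.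
  have [di ai _ _] := fP i; have [dj aj _ _] := fP j.
  have [dij tij] := domB di dj.
  have := graph_sum_bound dij (adjoint_graphD ai (adjoint_graphN aj)).
  rewrite tij; set p := _ + (_ - _); set q := _ - (_ + _) => -[b1 [b2 b3]].
  have [i1 i2] := limN i Ni; have [j1 j2] := limN j Nj.
  have : nrm p + nrm q < e / 4.
    have -> : p = (u - ((f j).1.1 + (f j).2)) - (u - ((f i).1.1 + (f i).2)).
      by rewrite /p; lin.
    have -> : q = (v - (t (f j).1.1 - (f j).1.2))
        - (v - (t (f i).1.1 - (f i).1.2)) by rewrite /q; lin.
    have := nrmB (u - ((f j).1.1 + (f j).2)) (u - ((f i).1.1 + (f i).2)).
    have := nrmB (v - (t (f j).1.1 - (f j).1.2))
      (v - (t (f i).1.1 - (f i).1.2)).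
    by lra.
  by move=> pq; split; lra.
have [|x xlim] := @nrm_complete R E (fun i => (f i).1.1).
  by move=> e /cau[N cN]; exists N => i j Ni Nj; have [] := cN i j Ni Nj.
have [|x' x'lim] := @nrm_complete R E (fun i => t (f i).1.1).
  by move=> e /cau[N cN]; exists N => i j Ni Nj; have [] := cN i j Ni Nj.
have [dx tx] : dom t x /\ t x = x'.
  apply: closed_graph => // e e0.
  have [N1 h1] := xlim e e0; have [N2 h2] := x'lim e e0.
  pose n := maxn N1 N2; have {}h1 := h1 n (leq_maxl _ _).
  have {}h2 := h2 n (leq_maxr _ _).
  by exists (f n).1.1; split=> //; have [] := fP n.
exists x, (t x - v), (u - x); split=> //; first last.
- by rewrite subKr.
- by rewrite addrC subrK.
apply: adjoint_graph_closed => e e0; have e20 : 0 < e / 2 by lra.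
have [N1 h1] := xlim _ e20; have [N2 h2] := x'lim _ e20.
have [N3 h3] := lim _ e20.
pose n := maxn (maxn N1 N2) N3.
have {}h1 := h1 n (leq_trans (leq_maxl _ _) (leq_maxl _ _)).
have {}h2 := h2 n (leq_trans (leq_maxr _ _) (leq_maxl _ _)).
have [h4 h5] := h3 n (leq_maxr _ _).
exists (f n).1.2, (f n).2; split; first by have [] := fP n.
- have -> : t x - v - (f n).1.2 = (t x - t (f n).1.1)
      - (v - (t (f n).1.1 - (f n).1.2)) by lin.
  by rewrite (le_lt_trans (nrmB _ _))// tx; lra.
- have -> : u - x - (f n).2 = (u - ((f n).1.1 + (f n).2)) - (x - (f n).1.1).
    by lin.
  by rewrite (le_lt_trans (nrmB _ _))//; lra.
Qed.

(** Dense range of [1 + t^* t] yields all [(u, 0)]; then [(0, y) = (z, 0) + (- z, y)], whose last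
    term is orthogonal to the graph for [z = t^* y], and such [y] are dense. *)
Lemma regular_graph_sum t : regular_op t -> forall u v, graph_sum t u v.
Proof.
move=> [tc td tad tr].
have left u : graph_sum t u 0.
  apply: graph_sum_closed => // e e0.
  have [_ [x [z [dx a ->]]] xz] := dense_nrm tr u e0.
  exists (x + z), 0; rewrite subrr nrm0; split=> //.
  by exists x, (t x), z; rewrite subrr.
have right v : graph_sum t 0 v.
  apply: graph_sum_closed => // e e0.
  have [y [z a] xy] := dense_nrm tad v e0.
  exists 0, y; rewrite subrr nrm0; split=> //.
  rewrite -(subrr z) -[y]add0r; apply: graph_sumD; last first.
    exists 0, (- y), (- z); rewrite add0r opprK; split=> //; first exact: dom0.
      exact: adjoint_graphN.
    by have := appZ 0 (dom0 t); rewrite !scale0r => ->; rewrite add0r.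
  exact: left.
by move=> u v; rewrite -[u]addr0 -[v]add0r; exact: graph_sumD.
Qed.

(** A decomposition of [(u, 0)] has [y = t x], hence [u = x + t^* t x]. *)
Lemma graph_sum_regular t : closed (graph t) -> dense (dom t) ->
  dense [set y | exists z, adjoint_graph t (y, z)] ->
  (forall u, graph_sum t u 0) -> regular_op t.
Proof.
move=> tc td tad h; split=> //; apply: nrm_dense => w e e0; exists w.
  have [x [y [z [dx a -> /esym/eqP]]]] := h w.
  by rewrite subr_eq0 => /eqP yE; exists x, z; rewrite yE.
by rewrite subrr nrm0.
Qed.

(** Formulated for a set of pairs, since the adjoint of [t] is available only as the relation
    [adjoint_graph t]. *)
Definition right_parametrix (Gamma : set (E * E)) := exists G T,
  (forall x, Gamma (G x, T x)) /\ compact_op (fun x => T x - x).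

(** If [(1 + S) Q = 1], then [T Q - 1 = (T - S - 1) Q] is compact. *)
Lemma right_parametrix_perturb (Gamma : set (E * E)) G T S (r : R) :
  (forall x, Gamma (G x, T x)) -> compact_op (fun x => T x - S x - x) ->
  0 <= r -> r <= 8^-1 -> (forall x, nrm (S x) <= r * nrm x) ->
  right_parametrix Gamma.
Proof.
move=> GT Kc r0 r8 Sr; have [Q QS] := one_plus_adjOp_inverse r0 r8 Sr.
have [G' G'E] := adjOp_comp G Q; have [T' T'E] := adjOp_comp T Q.
exists G', T'; rewrite G'E T'E; split=> [x|]; first exact: GT.
have := compact_compr Q Kc; congr compact_op; apply/funext => x.
by rewrite -[X in _ = _ - X](QS x); lin.
Qed.

Lemma adjOp_graph_closed T : closed (graph (unbOp_of_adjOp T)).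
Proof.
move=> [x y] /closure_nrm h; apply/graphP; split=> //=.
have [M M0 TM] := adjOp_bound T.
apply: (@nrm_small_eq _ _ _ _ (M + 1)) => e e0.
have [u [v [/graphP[_ /= <-] xu yv]]] := h e e0.
have -> : T x - y = T (x - u) - (y - T u) by rewrite adjOpB; lin.
rewrite (le_trans (nrmB _ _))//; have := TM (x - u).
by have := ler_wpM2l (ltW M0) (ltW xu); lra.
Qed.

Lemma one_mod_compact_of_closure t T :
  closure (graph t) = graph (unbOp_of_adjOp T) ->
  compact_op (fun x => T x - x) -> closure_one_mod_compact t.
Proof.
move=> tT Tc; split; last by exists T.
by move=> x y z; rewrite tT => /graphP[_ <-] /graphP[_ <-].
Qed.

Lemma fredholm_parametrix t : closed (graph t) -> dense (dom t) ->
  fredholm_op t <->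
  right_parametrix (graph t) /\ right_parametrix (adjoint_graph t).
Proof.
move=> tc td; split=> [[[G [_ [T [GT Tc]]]] [G' [_ [T' [GT' Tc']]]]]|].
  split.
    (* As [t] is closed, a point [(x, T' x)] in the closure of [t G'] forces [G' x] into the domain,
       with value [T' x]. *)
    exists G', T'; split=> // x; apply/graphP.
    have /closure_nrm h : closure (graph (unbOp_comp t (unbOp_of_adjOp G')))
      (x, T' x) by rewrite GT'; apply/graphP.
    have [M M0 GM] := adjOp_bound G'.
    apply: closed_graph => // e e0.
    have d0 : 0 < Num.min e (e / M) by rewrite lt_min e0 divr_gt0.
    have [u [v [/graphP[[_ du] /= <-]]]] := h _ d0; rewrite !lt_min.
    move=> /andP[_ xu] /andP[Tu _]; exists (G' u); split=> //.
    by rewrite -adjOpB (le_lt_trans (GM _))// mulrC -ltr_pdivlMr.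
  (* [G t] is a restriction of [T]; moved across the inner product, this puts [(G1 y, T1 y)] in the
     adjoint graph. *)
  have [G1 GG1] := adjOp_adjoint G; have [T1 TT1] := adjOp_adjoint T.
  exists G1, T1; split=> [y x dx /=|].
    rewrite -GG1 -TT1; congr inner.
    have : graph (unbOp_of_adjOp T) (x, G (t x)).
      by rewrite -GT; apply: subset_closure; apply/graphP.
    by case/graphP.
  apply: (compact_adj _ Tc) => x y.
  by rewrite innerDl innerDr innerNl innerNr TT1.
move=> [[G [T [GT Tc]]] [G' [T' [GT' Tc']]]]; split.
  (* Conversely [G1 t] agrees with [T1] on the dense set [dom t], so its closure is the bounded
     operator [T1]. *)
  have [G1 GG1] := adjOp_adjoint G'; have [T1 TT1] := adjOp_adjoint T'.
  have Gt x : dom t x -> G1 (t x) = T1 x.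
    move=> dx; apply: inner_inj => y; rewrite -GG1 -TT1 -inner_star.
    by rewrite -[RHS]inner_star; congr cstar; exact: (GT' y x dx).
  exists G1; apply: (@one_mod_compact_of_closure _ T1).
    apply/seteqP; split=> [p|[x y] /graphP[_ /= <-]].
      have : graph (unbOp_comp (unbOp_of_adjOp G1) t)
          `<=` graph (unbOp_of_adjOp T1).
        by move=> [x y] /graphP[[dx _] /= <-]; apply/graphP; rewrite /= Gt.
      by move=> /closure_subset sub /sub; exact: adjOp_graph_closed.
    apply/closure_nrm => e e0; have [M M0 TM] := adjOp_bound T1.
    have d0 : 0 < Num.min e (e / M) by rewrite lt_min e0 divr_gt0.
    have [u du] := dense_nrm td x d0; rewrite lt_min => /andP[xu xu'].
    exists u, (T1 u); split=> //; first by apply/graphP; rewrite /= Gt.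
    by rewrite -adjOpB (le_lt_trans (TM _))// mulrC -ltr_pdivlMr.
  apply: (compact_adj _ Tc') => x y.
  by rewrite innerDl innerDr innerNl innerNr TT1.
exists G; apply: (@one_mod_compact_of_closure _ T) => //.
have -> : graph (unbOp_comp t (unbOp_of_adjOp G)) = graph (unbOp_of_adjOp T).
  apply/seteqP; split=> [[x y] /graphP[_ /= <-]|[x y] /graphP[_ /= <-]].
    by apply/graphP; split=> //=; have /graphP[] := GT x.
  by apply/graphP; have /graphP[dG tG] := GT x; split.
apply/esym/closure_id; exact: adjOp_graph_closed.
Qed.

End Operators.

(** * Selfadjoint operators *)

Section SelfAdjoint.
Variables (R : realType) (A : cstarAlgType R) (E : hilbertModType A).
Implicit Types (x y z u v w : E) (t s : unbOp E E) (S T G : adjOp E E).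

Definition symmetric_op t := forall x y, dom t x -> dom t y ->
  inner (t x) y = inner x (t y).

Lemma selfadjointP t : selfadjoint_op t -> symmetric_op t /\
  forall y z, adjoint_graph t (y, z) -> dom t y /\ t y = z.
Proof.
move=> tE; split=> [x y dx dy|y z].
  have : adjoint_graph t (y, t y) by rewrite -tE; apply/graphP.
  exact.
by rewrite -tE => /graphP.
Qed.

Lemma conj_imul (mu : R) : conjc ('i%C * cplx mu) = - ('i%C * cplx mu).
Proof.
have -> : conjc ('i%C * cplx mu) = conjc 'i%C * conjc (cplx mu).
  exact: (rmorphM (@conjc R)).
by rewrite conj_i conjc_real mulNr.
Qed.

Definition ishift t (mu : R) x := t x + ('i%C * cplx mu) *: x.

Definition ishift_onto t (mu : R) :=
  forall w, exists2 x, dom t x & ishift t mu x = w.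

(** By symmetry the cross terms cancel and [<(t + i mu) x, (t + i mu) x> = <t x, t x> + mu^2 <x,
    x>], a sum of positive elements. *)
Lemma ishift_bound t (mu : R) x : symmetric_op t -> dom t x ->
  nrm (t x) <= nrm (ishift t mu x) /\ `|mu| * nrm x <= nrm (ishift t mu x).
Proof.
move=> tS dx.
have -> : nrm (ishift t mu x) = Num.sqrt (nrm (inner (t x) (t x)
    + inner (cplx mu *: x) (cplx mu *: x))).
  rewrite -[LHS]ger0_norm ?nrm_ge0// -sqrtr_sqr -nrm_inner_id.
  congr (Num.sqrt (nrm _)).
  rewrite /ishift !(innerDl, innerDr, innerZl, innerZr) conj_imul.
  rewrite conjc_real (tS x x)//.
  by linear_coefs R[i]; ring: (sqr_i R).
split.
  rewrite -[leLHS]ger0_norm ?nrm_ge0// -sqrtr_sqr ler_sqrt ?nrm_ge0//.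
  by apply: nrm_le_inner_add; exact: inner_ge0.
rewrite -nrmZr -[leLHS]ger0_norm ?nrm_ge0// -sqrtr_sqr ler_sqrt ?nrm_ge0//.
by rewrite addrC; apply: nrm_le_inner_add; exact: inner_ge0.
Qed.

Lemma ishift_onto_perturb t (mu r : R) (W : E -> E) : 0 <= r -> r < 1 ->
  (forall x y, dom t x -> dom t y -> W (x - y) = W x - W y) ->
  (forall x, dom t x -> nrm (W x) <= r * nrm (ishift t mu x)) ->
  ishift_onto t mu ->
  forall w, exists2 x, dom t x & ishift t mu x + W x = w.
Proof.
move=> r0 r1 WB Wr onto.
apply: (onto_perturb (@nrm_complete R E) (@nrm_ge0 R E) (nrm0 _)
  (@nrm_le0 R E) (@nrmD R E) (@nrmN R E) r0 r1
  (sub := fun x y => x - y)) => // x y dx dy.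
have [dxy txy] := domB dx dy; split=> //; last exact: WB.
by rewrite /ishift txy; lin.
Qed.

(** The difference [i (nu - mu) x] has norm at most [|mu| |x| / 2], hence at most half that of
    [(t + i mu) x]. *)
Lemma ishift_onto_step t (mu nu : R) : symmetric_op t -> ishift_onto t mu ->
  `|nu - mu| <= `|mu| / 2 -> ishift_onto t nu.
Proof.
move=> tS onto munu w.
have [||||x dx xw] := @ishift_onto_perturb t mu 2^-1
  (fun x => ('i%C * cplx (nu - mu)) *: x) _ _ _ _ onto w.
- by rewrite invr_ge0.
- by lra.
- by move=> x y _ _; lin.
- move=> x dx; have [_ h] := ishift_bound mu tS dx.
  rewrite -scalerA nrmZi nrmZr; have := ler_wpM2r (nrm_ge0 x) munu; lra.
by exists x => //; rewrite -xw /ishift; lin.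
Qed.

(** The ratio [3/2] is admissible in [ishift_onto_step] in both directions: the step is half of the
    smaller parameter and a third of the larger. *)
Lemma ishift_onto_pow t (mu : R) n : symmetric_op t ->
  ishift_onto t mu <-> ishift_onto t (mu * (3 / 2) ^+ n).
Proof.
move=> tS; elim: n => [|n IH]; first by rewrite expr0 mulr1.
have -> : mu * (3 / 2) ^+ n.+1 = mu * (3 / 2) ^+ n * (3 / 2).
  by rewrite exprSr !mulrA.
rewrite IH; move: (mu * _) => nu.
have nu0 := normr_ge0 nu; split => h; apply: (ishift_onto_step tS h).
  have -> : nu * (3 / 2) - nu = nu * 2^-1 by field.
  by rewrite normrM (ger0_norm (_ : 0 <= 2^-1))// invr_ge0.
have -> : nu - nu * (3 / 2) = - (nu * 2^-1) by field.
rewrite normrN !normrM (ger0_norm (_ : 0 <= 2^-1)) ?invr_ge0//.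
by rewrite [X in _ * (X * _)]ger0_norm//; lra.
Qed.

(** Decomposing [(w, 0)] gives [w = x + t^2 x = (t + i mu) (t - i mu) x], as [mu^2 = 1]. *)
Lemma selfadjoint_ishift_onto t (mu : R) : regular_op t -> selfadjoint_op t ->
  `|mu| = 1 -> ishift_onto t mu.
Proof.
move=> tr /selfadjointP[_ tA] mu1 w.
have [x [y [z [dx a -> /esym/eqP]]]] := regular_graph_sum tr w 0.
rewrite subr_eq0 => /eqP txy; rewrite -txy in a; have [dtx ttx] := tA _ _ a.
have mu2 : cplx mu * cplx mu = 1.
  by rewrite -rmorphM -expr2 -real_normK ?num_real// mu1 expr1n.
have dkx := domZ ('i%C * cplx mu) dx.
have [d1 t1] := domB dtx dkx.
exists (t x - ('i%C * cplx mu) *: x) => //.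
rewrite /ishift t1 ttx (appZ _ dx).
by linear_coefs R[i]; ring: (sqr_i R) mu2.
Qed.

(* In the second inclusion [y - x] is orthogonal to the range of [t - i], which
   is everything. *)
Lemma symmetric_onto_selfadjoint t : symmetric_op t ->
  ishift_onto t 1 -> ishift_onto t (-1) -> selfadjoint_op t.
Proof.
move=> tS o1 o2; apply/seteqP; split=> [[y z] /graphP[dy <-] x dx|[y z] a].
  exact: tS.
have [x dx xE] := o1 (z + 'i%C *: y); have [w dw wE] := o2 (y - x).
have a' : inner (t w) y = inner w z by exact: a.
have yx : y - x = 0.
  apply/nrm_eq0/eqP; rewrite -sqrf_eq0 -nrm_inner_id -{1}wE.
  have := congr1 (inner w) xE.
  rewrite /ishift !(innerDl, innerDr, innerNr, innerZl, innerZr) conj_imul.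
  rewrite a' tS// rmorphN rmorph1 mulr1 mulrN1 opprK => h.
  have -> : inner w z = inner w (t x) + 'i%C *: inner w x - 'i%C *: inner w y.
    by rewrite h; lin.
  set q := (X in nrm X); have -> : q = 0 by rewrite /q; lin.
  by rewrite nrm0.
have {yx}yx : y = x by apply/eqP; rewrite -subr_eq0 yx.
move: xE; rewrite /ishift rmorph1 mulr1 yx => /addIr tx.
by apply/graphP.
Qed.

(** The graph is closed because it equals the adjoint graph. Solving [(t + i) p = u] and then
    [(t - i) x = p] gives [x + t^2 x = u]. *)
Lemma symmetric_onto_regular t : symmetric_op t -> dense (dom t) ->
  ishift_onto t 1 -> ishift_onto t (-1) -> regular_op t /\ selfadjoint_op t.
Proof.
move=> tS td o1 o2; have ts := symmetric_onto_selfadjoint tS o1 o2.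
have tE : graph t = adjoint_graph t := ts.
split=> //; apply: graph_sum_regular => //.
- rewrite tE => -[y z] /closure_nrm h; apply: adjoint_graph_closed => e e0.
  by have [u [v [uv h1 h2]]] := h e e0; exists u, v.
- apply: nrm_dense => x e e0; have [y dy xy] := dense_nrm td x e0.
  by exists y => //; exists (t y); rewrite -tE; apply/graphP.
- move=> u; have [p dp pE] := o1 u; have [x dx xE] := o2 p.
  have txE : t x = p + 'i%C *: x.
    by rewrite -xE /ishift rmorphN rmorph1; lin.
  have tpE : t p = u - 'i%C *: p by rewrite -pE /ishift rmorph1; lin.
  have dtx : dom t (t x) by rewrite txE; apply: domD => //; exact: domZ.
  exists x, (t x), (t (t x)); rewrite subrr; split=> //.
    by rewrite -tE; apply/graphP.
  rewrite txE (appD dp (domZ _ dx)) (appZ _ dx) txE tpE.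
  by linear_coefs R[i]; ring: (sqr_i R).
Qed.

(** The formal adjoint [G' s] is defined only on [dom s]; density and the bound extend it. *)
Lemma adjOp_symmetric_comp s G (M : R) : symmetric_op s -> dense (dom s) ->
  (forall x, dom s (G x)) -> 0 <= M ->
  (forall x, nrm (s (G x)) <= M * nrm x) ->
  exists S, adjOp_fun S = fun x => s (G x).
Proof.
move=> sS sd Gs M0 GM; have [G' GG'] := adjOp_adjoint G.
apply: (@adjOp_of_dense _ _ _ _ (fun y => G' (s y)) (dom s) M) => // x y dy.
by rewrite sS// GG'.
Qed.

Lemma unbOp_add_symmetric t s : symmetric_op t -> symmetric_op s ->
  symmetric_op (unbOp_add t s).
Proof.
by move=> tS sS x y [tx sx] [ty sy]; rewrite /= innerDl innerDr tS// sS.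
Qed.

Lemma selfadjoint_fredholm t : regular_op t -> selfadjoint_op t ->
  fredholm_op t <-> right_parametrix (graph t).
Proof.
move=> [tc td _ _] tE; rewrite (fredholm_parametrix tc td) -tE.
by split=> [[]|].
Qed.

(** Surjectivity of [t + i mu] is carried from [|mu| = 1] up to [|mu| = (3/2)^n], where [s] is a
    small perturbation, and that of [t + s + i mu] is carried back down. *)
Lemma selfadjoint_add_small t s (r : R) : regular_op t -> selfadjoint_op t ->
  symmetric_op s -> dom t `<=` dom s -> 0 <= r -> r < 1 ->
  (exists n, forall mu x, `|mu| = (3 / 2) ^+ n -> dom t x ->
     nrm (s x) <= r * nrm (ishift t mu x)) ->
  regular_op (unbOp_add t s) /\ selfadjoint_op (unbOp_add t s).
Proof.
move=> tr ts sS ds r0 r1 [n sr]; have [tS _] := selfadjointP ts.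
have tsS := unbOp_add_symmetric tS sS.
have dE : dom (unbOp_add t s) = dom t by exact: setIidl.
have onto mu : `|mu| = 1 -> ishift_onto (unbOp_add t s) mu.
  move=> mu1; apply/(ishift_onto_pow _ n tsS).
  have muE : `|mu * (3 / 2) ^+ n| = (3 / 2 : R) ^+ n.
    by rewrite normrM mu1 mul1r ger0_norm// exprn_ge0.
  move=> w; have := selfadjoint_ishift_onto tr ts mu1.
  move=> /(ishift_onto_pow _ n tS) on.
  have [||x dx xw] := @ishift_onto_perturb t _ r s r0 r1 _ _ on w.
  - by move=> x y /ds dx /ds dy; have [] := domB dx dy.
  - by move=> x dx; apply: sr.
  exists x; first by rewrite dE.
  by rewrite -xw /ishift /=; lin.
apply: symmetric_onto_regular => //.
- by rewrite dE; case: tr.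
- by apply: onto; rewrite normr1.
- by apply: onto; rewrite normrN1.
Qed.

End SelfAdjoint.

(** * The gap metric *)

Section OperatorNorm.
Variables (R : realType) (A : cstarAlgType R).

Lemma hnormZ (F : semiInnerModType A) (c : R) (x : F) : 0 <= c ->
  hnorm (cplx c *: x) = c * hnorm x.
Proof.
move=> c0; rewrite !hnormE innerZl innerZr conjc_real !nrmZr mulrA.
by rewrite sqrtrM ?mulr_ge0// -expr2 sqrtr_sqr normr_id ger0_norm.
Qed.

(** Only positive homogeneity is assumed, which suits differences of graph projections. The bound
    [M] serves to make the supremum meaningful. *)
Lemma opnorm_le (F F' : semiInnerModType A) (f : F -> F') (M : R) :
  (forall (c : R) x, 0 < c -> f (cplx c *: x) = cplx c *: f x) ->
  (forall x, hnorm (f x) <= M * hnorm x) ->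
  forall x, hnorm (f x) <= opnorm f * hnorm x.
Proof.
move=> fZ fM x; have := hnorm_ge0 x; rewrite le_eqVlt => /orP[/eqP x0|x0].
  by have := fM x; rewrite -x0 !mulr0.
have c0 : 0 < (hnorm x)^-1 by rewrite invr_gt0.
rewrite -ler_pdivrMr// mulrC -(hnormZ _ (ltW c0)) -fZ//.
apply: ub_le_sup; last first.
  exists (cplx (hnorm x)^-1 *: x) => //=.
  by rewrite hnormZ ?mulVf ?gt_eqF// ltW.
exists `|M| => _ [y /= y1 <-]; rewrite (le_trans (fM y))//.
rewrite (@le_trans _ _ (`|M| * hnorm y))//.
  by rewrite ler_wpM2r ?hnorm_ge0// ler_norm.
by rewrite ler_piMr.
Qed.

Lemma adjOp_opnorm (E : hilbertModType A) (T : adjOp E E) x :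
  nrm (T x) <= opnorm T * nrm x.
Proof.
have [M M0 TM] := adjOp_bound T; rewrite -!hnorm_nrm.
apply: (@opnorm_le _ _ _ M) => [c y _|y]; first exact: adjOpZ.
by rewrite !hnorm_nrm.
Qed.

End OperatorNorm.

(** * Orthogonal projections onto graphs and transport of parametrices *)

Section Gap.
Variables (R : realType) (A : cstarAlgType R) (E : hilbertModType A).
Implicit Types (x y z u v w : E) (p q r : E * E) (t s : unbOp E E).
Implicit Types (S T G : adjOp E E).

Lemma inner_pair p q : inner p q = inner p.1 q.1 + inner p.2 q.2.
Proof. by []. Qed.

Lemma hnorm_pair_ge p : nrm p.1 <= hnorm p /\ nrm p.2 <= hnorm p.
Proof.
split; rewrite hnormE -[leLHS]ger0_norm ?nrm_ge0// -sqrtr_sqr;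
  rewrite ler_sqrt ?nrm_ge0//.
  exact/nrm_le_inner_add/inner_ge0.
by rewrite inner_pair addrC; exact/nrm_le_inner_add/inner_ge0.
Qed.

Lemma sqrt_nrm_inner_add x y :
  Num.sqrt (nrm (inner x x + inner y y)) <= nrm x + nrm y.
Proof.
rewrite -[leRHS]ger0_norm ?addr_ge0 ?nrm_ge0// -sqrtr_sqr ler_sqrt ?sqr_ge0//.
rewrite (le_trans (nrmD _ _))// !nrm_inner_id sqrrD -addrA lerD2l lerDr.
by rewrite mulrn_wge0// mulr_ge0 ?nrm_ge0.
Qed.

Lemma hnorm_pair_le p : hnorm p <= nrm p.1 + nrm p.2.
Proof. exact: sqrt_nrm_inner_add. Qed.

Lemma graph_proj_spec t p : regular_op t -> graph t (graph_proj t p) /\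
  forall r, graph t r -> inner r (p - graph_proj t p) = 0.
Proof.
move=> tr; suff : [set q | graph t q /\
    forall r, graph t r -> inner r (p - q) = 0] (graph_proj t p) by [].
apply: xgetPex; case: p => u v.
have [x [y [z [dx a -> ->]]]] := regular_graph_sum tr u v.
exists (x, t x); split=> [|[r1 r2] /graphP[d1 <-]]; first exact/graphP.
rewrite inner_pair /= [x + z]addrC addrK [t x - y]addrC addrK innerNr.
have -> : inner (t r1) y = inner r1 z by exact: a.
by rewrite subrr.
Qed.

Lemma graph_sub t p q : graph t p -> graph t q -> graph t (p - q).
Proof.
case: p q => [p1 p2] [q1 q2] /graphP[dp <-] /graphP[dq <-].
by have [d tE] := domB dp dq; exists (p1 - q1) => //; rewrite tE.
Qed.

Lemma graph_proj_unique t p q : regular_op t -> graph t q ->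
  (forall r, graph t r -> inner r (p - q) = 0) -> graph_proj t p = q.
Proof.
move=> tr tq qo; have [tp po] := graph_proj_spec p tr.
apply/eqP; rewrite -subr_eq0; apply/eqP; set d := graph_proj t p - q.
have td : graph t d by exact: graph_sub.
have d0 : inner d d = 0.
  have {2}-> : d = (p - q) - (p - graph_proj t p).
    by rewrite /d opprB [RHS]addrC subrKA.
  by rewrite innerDr innerNr qo// po// subrr.
have h0 : hnorm d = 0 by rewrite hnormE d0 nrm0 sqrtr0.
have [] := hnorm_pair_ge d; rewrite h0 => /nrm_le0 e1 /nrm_le0 e2.
by rewrite [LHS]surjective_pairing e1 e2.
Qed.

Lemma graph_projZ t (c : R) p : regular_op t ->
  graph_proj t (cplx c *: p) = cplx c *: graph_proj t p.
Proof.
move=> tr; have [tp po] := graph_proj_spec p tr.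
apply: graph_proj_unique => // [|r rt]; last first.
  by rewrite -scalerBr innerZr po// scaler0.
case: (graph_proj t p) tp => x y /graphP[dx <-].
by exists (cplx c *: x); [exact: domZ|rewrite appZ].
Qed.

Lemma graph_proj_sym t p q : regular_op t ->
  inner (graph_proj t p) q = inner p (graph_proj t q).
Proof.
move=> tr; have [tp po] := graph_proj_spec p tr.
have [tq qo] := graph_proj_spec q tr.
have -> : inner (graph_proj t p) q = inner (graph_proj t p) (graph_proj t q).
  by apply/eqP; rewrite -subr_eq0 -innerNr -innerDr qo.
apply/esym; rewrite -inner_star -[RHS]inner_star; congr cstar.
by apply/eqP; rewrite -subr_eq0 -innerNr -innerDr po.
Qed.

Lemma graph_proj_le t p : regular_op t -> hnorm (graph_proj t p) <= hnorm p.
Proof.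
move=> tr; have [tp po] := graph_proj_spec p tr.
set q := graph_proj t p in tp po *.
have pE : inner p p = inner q q + inner (p - q) (p - q).
  have qp : inner q p = inner q q.
    by apply/eqP; rewrite -subr_eq0 -innerNr -innerDr po.
  have pq : inner p q = inner q q by rewrite -inner_star qp inner_star.
  by rewrite !(innerDl, innerDr, innerNl, innerNr) qp pq; lin.
by rewrite !hnormE ler_sqrt ?nrm_ge0// pE cpositive_mono//; exact: inner_ge0.
Qed.

Lemma graph_proj_gap t s p : regular_op t -> regular_op s ->
  hnorm (graph_proj t p - graph_proj s p) <= gap t s * hnorm p.
Proof.
(* The 4 is a crude a priori bound: each of the two coordinates of a difference of contractions
   contributes at most 2. *)
move=> tr sr; apply: (@opnorm_le _ _ _ _
  (fun p => graph_proj t p - graph_proj s p) 4 _ _ p) => [c q _|q].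
  by rewrite !graph_projZ// scalerBr.
have := graph_proj_le q tr; have := graph_proj_le q sr.
have [t1 t2] := hnorm_pair_ge (graph_proj t q).
have [s1 s2] := hnorm_pair_ge (graph_proj s q).
have := hnorm_pair_le (graph_proj t q - graph_proj s q).
have := nrmB (graph_proj t q).1 (graph_proj s q).1.
have := nrmB (graph_proj t q).2 (graph_proj s q).2.
rewrite -/((graph_proj t q - graph_proj s q).1).
rewrite -/((graph_proj t q - graph_proj s q).2).
lra.
Qed.

Lemma adjOp_opp T : exists S, adjOp_fun S = fun x => - T x.
Proof.
have [T' TT'] := adjOp_adjoint T; have [M M0 TM] := adjOp_bound T.
apply: (@adjOp_exists _ _ _ _ (fun x => - T' x) M) => [x y|x].
  by rewrite innerNl innerNr TT'.
by rewrite nrmN.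
Qed.

(** The projection is symmetric, so the adjoints of the two coordinates send [y] to the projections
    of [(y, 0)] and [(0, y)], followed by the adjoint of the column [(G, T)]. *)
Lemma graph_proj_adjOp s G T : regular_op s -> exists G' T',
  forall x, graph_proj s (G x, T x) = (G' x, T' x).
Proof.
move=> sr; have [G1 GG1] := adjOp_adjoint G; have [T1 TT1] := adjOp_adjoint T.
have [M M0 GM] := adjOp_bound G; have [N N0 TN] := adjOp_bound T.
pose P x := graph_proj s (G x, T x).
have Pb x : hnorm (P x) <= (M + N) * nrm x.
  rewrite (le_trans (graph_proj_le _ sr))// (le_trans (hnorm_pair_le _))//=.
  by rewrite mulrDl lerD.
have adj x (q : E * E) : inner (P x) q
    = inner x (G1 (graph_proj s q).1 + T1 (graph_proj s q).2).
  by rewrite graph_proj_sym// inner_pair innerDr GG1 TT1.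
have [|x|G' G'E] := @adjOp_exists _ _ E (fun x => (P x).1)
    (fun y => G1 (graph_proj s (y, 0)).1 + T1 (graph_proj s (y, 0)).2) (M + N).
- by move=> x y; rewrite -adj inner_pair /= inner0r addr0.
- by have [h _] := hnorm_pair_ge (P x); exact: le_trans (Pb x).
have [|x|T' T'E] := @adjOp_exists _ _ E (fun x => (P x).2)
    (fun y => G1 (graph_proj s (0, y)).1 + T1 (graph_proj s (0, y)).2) (M + N).
- by move=> x y; rewrite -adj inner_pair /= inner0r add0r.
- by have [_ h] := hnorm_pair_ge (P x); exact: le_trans (Pb x).
by exists G', T' => x; rewrite G'E T'E -surjective_pairing.
Qed.

(** The projection onto the graph of [t] fixes [(G x, T x)], so projecting onto the graph of [s]
    moves it by at most [e M |x|]. *)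
Lemma right_parametrix_gap t s G T (e M : R) : regular_op t -> regular_op s ->
  (forall x, graph t (G x, T x)) -> compact_op (fun x => T x - x) ->
  (forall x, nrm (G x) + nrm (T x) <= M * nrm x) ->
  0 <= M -> 0 <= e -> e * M <= 8^-1 -> gap s t <= e ->
  right_parametrix (graph s).
Proof.
move=> tr sr GT Tc GTM M0 e0 eM ge.
have [G' [T' PE]] := graph_proj_adjOp G T sr.
have [NT NTE] := adjOp_opp T; have [S SE] := adjOp_add T' NT.
apply: (@right_parametrix_perturb _ _ _ _ G' T' S (e * M)) => //.
- by move=> x; rewrite -PE; have [] := graph_proj_spec (G x, T x) sr.
- move: Tc; congr compact_op; apply/funext => x; rewrite SE NTE; lin.
- exact: mulr_ge0.
move=> x; rewrite SE NTE.
have Pt : graph_proj t (G x, T x) = (G x, T x).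
  by apply: graph_proj_unique => // r _; rewrite subrr inner0r.
have := graph_proj_gap (G x, T x) sr tr; rewrite PE Pt => h.
have [_ h'] := hnorm_pair_ge ((G' x, T' x) - (G x, T x)).
apply: (le_trans h'); apply: (le_trans h); rewrite -mulrA.
rewrite (le_trans (ler_wpM2r (hnorm_ge0 _) ge))// ler_wpM2l//.
by apply: le_trans (hnorm_pair_le _) _; exact: GTM.
Qed.

(** The pair [(T y, - G y)] is orthogonal to the graph of [t], so its projection [(H1 y, H2 y)] onto
    the graph of [s] is small; subtracting it puts [(G + H2, T - H1)] in the adjoint graph of
    [s]. *)
Lemma adjoint_parametrix_gap t s G T (e M : R) : regular_op t -> regular_op s ->
  (forall x, adjoint_graph t (G x, T x)) -> compact_op (fun x => T x - x) ->
  (forall x, nrm (G x) + nrm (T x) <= M * nrm x) ->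
  0 <= M -> 0 <= e -> e * M <= 8^-1 -> gap s t <= e ->
  right_parametrix (adjoint_graph s).
Proof.
move=> tr sr GT Tc GTM M0 e0 eM ge; have [NG NGE] := adjOp_opp G.
have [H1 [H2 PE]] := graph_proj_adjOp T NG sr.
have [S SE] := adjOp_opp H1; have [T' T'E] := adjOp_add T S.
have [G' G'E] := adjOp_add G H2.
apply: (@right_parametrix_perturb _ _ _ _ G' T' S (e * M)) => //.
- move=> y x dx /=; rewrite G'E T'E SE.
  have [_ /(_ (x, s x))] := graph_proj_spec (T y, NG y) sr.
  rewrite PE NGE inner_pair /= => h.
  have {}h := h (ex_intro2 _ _ x dx erefl).
  apply/eqP; rewrite eq_sym -subr_eq0 -h !(innerDr, innerNr); apply/eqP; lin.
- by move: Tc; congr compact_op; apply/funext => x; rewrite T'E; lin.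
- exact: mulr_ge0.
move=> y; rewrite SE nrmN.
have Pt : graph_proj t (T y, NG y) = 0.
  apply: graph_proj_unique => //.
    exists 0; first exact: dom0.
    by have := appZ 0 (dom0 t); rewrite !scale0r => ->.
  move=> [r1 r2] /graphP[d1 <-]; rewrite subr0 inner_pair /= NGE innerNr.
  have -> : inner (t r1) (G y) = inner r1 (T y) by exact: (GT y r1 d1).
  by rewrite subrr.
have := graph_proj_gap (T y, NG y) sr tr; rewrite PE Pt subr0 => h.
have [h' _] := hnorm_pair_ge (H1 y, H2 y).
apply: (le_trans h'); apply: (le_trans h); rewrite -mulrA.
rewrite (le_trans (ler_wpM2r (hnorm_ge0 _) ge))// ler_wpM2l//.
by apply: le_trans (hnorm_pair_le _) _; rewrite /= NGE nrmN addrC.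
Qed.

End Gap.

(** * Perturbations *)

Section Perturbations.
Variables (R : realType) (A : cstarAlgType R) (E : hilbertModType A).
Implicit Types (x y z u v w : E) (t s : unbOp E E) (S T G : adjOp E E).

(** For [D + t] the decomposition map on triples [(x, y, z)], with last entry [D y + z], is the one
    for [t] plus [(D y, D x)]. *)
Lemma regular_add_bounded t D (e : R) : regular_op t ->
  selfadjoint_op (unbOp_of_adjOp D) -> (forall x, nrm (D x) <= e * nrm x) ->
  0 <= e -> e <= 16^-1 -> regular_op (unbOp_add (unbOp_of_adjOp D) t).
Proof.
move=> tr DS De e0 e16; have [tc td tad _] := tr.
have DD x y : inner (D x) y = inner x (D y).
  by have [h _] := selfadjointP DS; exact: h.
have dE : dom (unbOp_add (unbOp_of_adjOp D) t) = dom t by exact: setTI.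
have adj y z : adjoint_graph t (y, z) ->
    adjoint_graph (unbOp_add (unbOp_of_adjOp D) t) (y, D y + z).
  move=> a x [_ dx] /=; rewrite innerDl innerDr DD; congr (_ + _); exact: a.
apply: graph_sum_regular; first last.
(* In this norm [graph_sum_bound] makes the perturbation at most [8 e <= 1/2] times the unperturbed
   map. *)
- move=> u; pose n (p : E * E) := nrm p.1 + nrm p.2.
  have n_compl : n_complete n.
    move=> f cf; have [|l1 h1] := @nrm_complete R E (fun i => (f i).1).
      move=> d /cf[N cN]; exists N => i j Ni Nj.
      by rewrite (le_lt_trans _ (cN i j Ni Nj))// lerDl nrm_ge0.
    have [|l2 h2] := @nrm_complete R E (fun i => (f i).2).
      move=> d /cf[N cN]; exists N => i j Ni Nj.
      by rewrite (le_lt_trans _ (cN i j Ni Nj))// lerDr nrm_ge0.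
    exists (l1, l2) => d d0; have d20 : 0 < d / 2 by lra.
    have [N1 k1] := h1 _ d20; have [N2 k2] := h2 _ d20.
    exists (maxn N1 N2) => i; rewrite geq_max => /andP[i1 i2].
    by have := k1 i i1; have := k2 i i2; rewrite /n /=; lra.
  have n_ge0 p : 0 <= n p by rewrite addr_ge0 ?nrm_ge0.
  have n0 : n 0 = 0 by rewrite /n /= !nrm0 addr0.
  have n_le0 p : n p <= 0 -> p = 0.
    case: p => p1 p2; rewrite /n /= => np.
    have p10 := nrm_ge0 p1; have p20 := nrm_ge0 p2.
    have -> : p1 = 0 by apply: nrm_le0; lra.
    by have -> : p2 = 0 by apply: nrm_le0; lra.
  have nD p q : n (p + q) <= n p + n q.
    by rewrite /n; have := nrmD p.1 q.1; have := nrmD p.2 q.2; rewrite /=; lra.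
  have nN p : n (- p) = n p by rewrite /n /= !nrmN.
  have half0 : 0 <= 2^-1 :> R by rewrite invr_ge0.
  have half1 : 2^-1 < 1 :> R by lra.
  have [|||[[x y] z] [/= dx a] [xu yv]] :=
    onto_perturb n_compl n_ge0 n0 n_le0 nD nN half0 half1
    (D := [set p : E * E * E | dom t p.1.1 /\ adjoint_graph t (p.1.2, p.2)])
    (sub := fun p q => (p.1.1 - q.1.1, p.1.2 - q.1.2, p.2 - q.2))
    (P := fun p => (p.1.1 + p.2, t p.1.1 - p.1.2))
    (W := fun p => (D p.1.2, D p.1.1)) _ _ _ (u, 0).
  + move=> [[x y] z] [[x' y'] z'] [/= dx a] [/= dx' a'].
    have [dxx txx] := domB dx dx'; split=> //=.
    * by split=> //; apply: adjoint_graphD => //; exact: adjoint_graphN.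
    * rewrite txx; congr (_, _) => /=; lin.
    * by rewrite !adjOpB.
  + move=> [v w]; have [x [y [z [dx a -> ->]]]] := regular_graph_sum tr v w.
    by exists (x, y, z).
  + move=> [[x y] z] [/= dx a]; rewrite /n /=.
    have [b1 [_ b2]] := graph_sum_bound dx a.
    have := De x; have := De y.
    have := ler_wpM2r (nrm_ge0 x) e16; have := ler_wpM2r (nrm_ge0 y) e16.
    lra.
  exists x, y, (D y + z); split=> //=.
  + exact: adj.
  + by rewrite -xu /=; lin.
  + by rewrite -yv /=; lin.
- apply: nrm_dense => x d d0; have [y [z a] xy] := dense_nrm tad x d0.
  by exists y => //; exists (D y + z); exact: adj.
- by rewrite dE.
move=> [x y] /closure_nrm h; apply/graphP; rewrite dE /=.
suff [dx tx] : dom t x /\ t x = y - D x by split=> //; rewrite tx subrKC.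
apply: closed_graph => // d d0; have d20 : 0 < d / 2 by lra.
have [u [v [/graphP[[_ du] /= <-] xu yv]]] := h _ d20.
exists u; split=> //; first by lra.
have -> : y - D x - t u = (y - (D u + t u)) - D (x - u).
  by rewrite adjOpB; lin.
rewrite (le_lt_trans (nrmB _ _))//; have := De (x - u).
have := ler_wpM2r (nrm_ge0 (x - u)) e16; have := nrm_ge0 (x - u); lra.
Qed.

Lemma fredholm_add_bounded t D G T G' T' (e M : R) :
  let Dt := unbOp_add (unbOp_of_adjOp D) t in
  regular_op Dt -> selfadjoint_op (unbOp_of_adjOp D) ->
  (forall x, nrm (D x) <= e * nrm x) ->
  (forall x, graph t (G x, T x)) -> compact_op (fun x => T x - x) ->
  (forall x, adjoint_graph t (G' x, T' x)) -> compact_op (fun x => T' x - x) ->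
  (forall x, nrm (G x) <= M * nrm x) -> (forall x, nrm (G' x) <= M * nrm x) ->
  0 <= M -> 0 <= e -> e * M <= 8^-1 -> fredholm_op Dt.
Proof.
move=> Dt Dtr DS De GT Tc GT' Tc' GM GM' M0 e0 eM; have [Dtc Dtd _ _] := Dtr.
have DD x y : inner (D x) y = inner x (D y).
  by have [h _] := selfadjointP DS; exact: h.
apply/fredholm_parametrix => //; split.
  have [S SE] := adjOp_comp D G; have [U UE] := adjOp_add S T.
  apply: (@right_parametrix_perturb _ _ _ _ G U S (e * M)) => //.
  - move=> x; have /graphP[dG tG] := GT x; apply/graphP.
    by rewrite UE SE /= tG.
  - by move: Tc; congr compact_op; apply/funext => x; rewrite UE; lin.
  - exact: mulr_ge0.
  - by move=> x; rewrite SE (le_trans (De _))// -mulrA ler_wpM2l.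
have [S SE] := adjOp_comp D G'; have [U UE] := adjOp_add S T'.
apply: (@right_parametrix_perturb _ _ _ _ G' U S (e * M)) => //.
- move=> y x [_ dx] /=; rewrite UE SE innerDl innerDr DD; congr (_ + _).
  exact: (GT' y x dx).
- by move: Tc'; congr compact_op; apply/funext => x; rewrite UE; lin.
- exact: mulr_ge0.
- by move=> x; rewrite SE (le_trans (De _))// -mulrA ler_wpM2l.
Qed.

Lemma graphMod_hnorm t (z : graphMod t) :
  hnorm z <= nrm (gval z) + nrm (t (gval z)).
Proof. exact: sqrt_nrm_inner_add. Qed.

Lemma nrm_mact x (a : A) : nrm (mact x a) <= nrm x * nrm a.
Proof.
rewrite -(@ler_pXn2r _ 2) ?nnegrE ?mulr_ge0 ?nrm_ge0//.
rewrite -nrm_inner_id inner_mact inner_mactl (le_trans (nrm_cmul _ _))//.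
have := nrm_cmul (cstar a) (inner x x).
rewrite nrm_cstar nrm_inner_id => /(ler_wpM2r (nrm_ge0 a)) /le_trans; apply.
by rewrite exprMn mulrAC mulrC -expr2 mulrC.
Qed.

(* As [dom t] is dense, [t p] may be replaced by some [y] in [dom t] in the
   inner product <p, z> + <t p, t z> of E(t), and then moved to the right. *)
Lemma graph_inner_relbound t (p : graphMod t) (e : R) : symmetric_op t ->
  dense (dom t) -> 0 < e -> exists2 C : R, 0 <= C &
  forall z : graphMod t,
    nrm (inner p z) <= e * nrm (t (gval z)) + C * nrm (gval z).
Proof.
move=> tS td e0; have e40 : 0 < e / 4 by lra.
have [y dy py] := dense_nrm td (t (gval p)) e40.
exists (4 * (nrm (gval p) + nrm (t y))) => [|z].
  by rewrite mulr_ge0// addr_ge0 ?nrm_ge0.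
have -> : inner p z = inner (gval p) (gval z) + (inner (t y) (gval z)
    + inner (t (gval p) - y) (t (gval z))).
  rewrite -[LHS]/(inner (gval p) (gval z) + inner (t (gval p)) (t (gval z))).
  by rewrite innerDl innerNl (tS _ _ dy (gval_dom z)); lin.
rewrite (le_trans (nrmD _ _))//.
have := nrmD (inner (t y) (gval z)) (inner (t (gval p) - y) (t (gval z))).
have := nrm_inner (gval p) (gval z); have := nrm_inner (t y) (gval z).
have := nrm_inner (t (gval p) - y) (t (gval z)).
have := ler_wpM2r (nrm_ge0 (t (gval z))) (ltW py); lra.
Qed.

(** A finite rank operator approximates [s] up to [e / 2] times the graph norm, and each of its
    terms has arbitrarily small [t]-bound by [graph_inner_relbound]. *)
Lemma relatively_compact_relbound t s (e : R) :
  symmetric_op t -> dense (dom t) ->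
  relatively_compact t s -> 0 < e -> exists2 C : R, 0 <= C &
  forall x, dom t x -> nrm (s x) <= e * nrm (t x) + C * nrm x.
Proof.
move=> tS td [ds sc] e0.
have sum (ps : seq (E * graphMod t)) (d : R) : 0 < d ->
    exists2 C : R, 0 <= C & forall z : graphMod t,
    nrm (\sum_(p <- ps) mact p.1 (inner p.2 z))
      <= d * nrm (t (gval z)) + C * nrm (gval z).
  elim: ps d => [|p ps IH] d d0.
    exists 0 => // z; rewrite big_nil nrm0 mul0r addr0.
    by rewrite mulr_ge0 ?nrm_ge0// ltW.
  have d20 : 0 < d / 2 by lra.
  have p0 : 0 < nrm p.1 + 1 by rewrite ltr_wpDl ?nrm_ge0.
  have [C C0 hC] := IH _ d20.
  have [B B0 hB] := graph_inner_relbound p.2 tS td (divr_gt0 d20 p0).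
  exists ((nrm p.1 + 1) * B + C) => [|z].
    by rewrite addr_ge0// mulr_ge0// ltW.
  rewrite big_cons (le_trans (nrmD _ _))//.
  have h1 := nrm_mact p.1 (inner p.2 z).
  have h2 := ler_wpM2l (ltW p0) (hB z).
  have h3 : nrm p.1 * nrm (inner p.2 z) <= (nrm p.1 + 1) * nrm (inner p.2 z).
    by rewrite ler_wpM2r ?nrm_ge0// lerDl.
  have h4 : (nrm p.1 + 1) * (d / 2 / (nrm p.1 + 1) * nrm (t (gval z))
      + B * nrm (gval z)) = d / 2 * nrm (t (gval z))
      + (nrm p.1 + 1) * B * nrm (gval z).
    by field; rewrite gt_eqF.
  by rewrite h4 in h2; have := hC z; lra.
have e20 : 0 < e / 2 by lra.
have [ps sps] := sc _ e20; have [C C0 hC] := sum ps _ e20.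
exists (e / 2 + C) => [|x dx]; first by rewrite addr_ge0// ltW.
have xd : x \in dom_pred t by exact/asboolP.
pose z := GraphMod xd; have := hC z; have := sps z; rewrite hnorm_nrm /=.
have := ler_wpM2l (ltW e20) (graphMod_hnorm z); rewrite /=.
set q := \sum_(_ <- _) _; have := nrmD (s x - q) q; rewrite subrK; lra.
Qed.

(** As [t G = T], the form [<p, G x> + <t p, T x>] of [E(t)] equals [<G' p + T' (t p), x>], so
    finite rank operators on [E(t)] composed with [G] have finite rank on [E]. *)
Lemma relatively_compact_comp t s G T : relatively_compact t s ->
  (forall x, graph t (G x, T x)) -> compact_op (fun x => s (G x)).
Proof.
move=> [ds sc] GT e e0.
have [G' GG'] := adjOp_adjoint G; have [T' TT'] := adjOp_adjoint T.
have [M M0 GM] := adjOp_bound G; have [N N0 TN] := adjOp_bound T.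
have MN0 : 0 < M + N by rewrite addr_gt0.
have [ps sps] := sc _ (divr_gt0 e0 MN0).
exists [seq (p.1, G' (gval p.2) + T' (t (gval p.2))) | p <- ps] => x.
have /graphP[dGx tGx] := GT x.
have xd : G x \in dom_pred t by exact/asboolP.
have := sps (GraphMod xd); rewrite big_map /=.
under [X in _ -> hnorm (_ - X) <= _]eq_bigr => p _.
  have -> : inner (G' (gval p.2) + T' (t (gval p.2))) x
      = inner p.2 (GraphMod xd).
    rewrite innerDl !(hadj_sym GG', hadj_sym TT') -tGx; reflexivity.
  over.
move=> /le_trans; apply; rewrite hnorm_nrm.
have h := graphMod_hnorm (GraphMod xd); rewrite /= tGx in h.
rewrite mulrAC ler_pdivrMr// -mulrA ler_wpM2l ?(ltW e0)// (le_trans h)//.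
by have := GM x; have := TN x; lra.
Qed.

(** On the range of [G] the sum acts as [T + s G]; a small [s G] is absorbed by inverting [1 + s G],
    a compact one by the compact remainder. *)
Lemma selfadjoint_add_fredholm t s G T (M : R) :
  let ts := unbOp_add t s in regular_op ts -> selfadjoint_op ts ->
  symmetric_op s -> dense (dom s) -> dom t `<=` dom s ->
  (forall x, graph t (G x, T x)) -> compact_op (fun x => T x - x) ->
  0 <= M -> (forall x, nrm (s (G x)) <= M * nrm x) ->
  M <= 8^-1 \/ compact_op (fun x => s (G x)) -> fredholm_op ts.
Proof.
move=> ts tsr tss sS sd ds GT Tc M0 sGM small.
apply/selfadjoint_fredholm => //.
have Gs x : dom s (G x) by apply: ds; have /graphP[] := GT x.
have [S SE] := adjOp_symmetric_comp sS sd Gs M0 sGM.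
have [U UE] := adjOp_add T S.
have GU x : graph ts (G x, U x).
  by have /graphP[dG tG] := GT x; apply/graphP; rewrite UE SE /= tG.
case: small => [M8|Sc].
  apply: (@right_parametrix_perturb _ _ _ _ G U S M) => //.
    by move: Tc; congr compact_op; apply/funext => x; rewrite UE; lin.
  by move=> x; rewrite SE.
exists G, U; split=> //; rewrite UE SE.
have := compact_add Tc Sc; congr compact_op; apply/funext => x; lin.
Qed.

Lemma unbOp_ext t s : dom t = dom s -> (t : E -> E) = s -> t = s.
Proof.
case: t s => d f d1 d2 d3 d4 [d' f' d1' d2' d3' d4'] /= dd ff.
by subst d' f'; f_equal; exact: Prop_irrelevance.
Qed.

Lemma unbOp_addC t s : unbOp_add s t = unbOp_add t s.
Proof.
by apply: unbOp_ext; [exact: setIC|apply/funext => x; exact: addrC].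
Qed.

Lemma exp_three_halves_ge (C : R) : exists n, C <= (3 / 2) ^+ n.
Proof.
have bern n : n%:R / 2 <= (3 / 2) ^+ n :> R.
  elim: n => [|n IH]; first by rewrite mul0r expr0.
  have one : 1 <= (3 / 2) ^+ n :> R by rewrite exprn_ege1//; lra.
  by rewrite exprSr -[n.+1%:R]natr1; lra.
exists (Num.trunc (2 * C)).+1; apply: le_trans (bern _).
by rewrite ler_pdivlMr// mulrC ltW// truncnS_gt.
Qed.

End Perturbations.

Theorem theorem1p3 (R : realType) (A : cstarAlgType R) (E : hilbertModType A) :
  (forall t : unbOp E E, regular_op t -> fredholm_op t ->
    exists e : R,
      [/\ 0 < e,
          (forall D : adjOp E E,
             selfadjoint_op (unbOp_of_adjOp D) -> opnorm D <= e ->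
             let Dt := unbOp_add (unbOp_of_adjOp D) t in
             regular_op Dt /\ fredholm_op Dt),
          (selfadjoint_op t ->
           forall s : unbOp E E, regular_op s -> selfadjoint_op s ->
             dom t `<=` dom s ->
             (forall x, dom t x ->
                hnorm (s x) <= e * (hnorm (t x + s x) + hnorm x)) ->
             let ts := unbOp_add t s in
             [/\ regular_op ts, selfadjoint_op ts & fredholm_op ts])
        & (forall s : unbOp E E, regular_op s -> gap s t <= e ->
             fredholm_op s)]) /\
  (unital A -> countably_generated E ->
   forall t s : unbOp E E,
     regular_op t -> selfadjoint_op t -> regular_op s -> selfadjoint_op s ->
     fredholm_op t -> relatively_compact t s ->
     let st := unbOp_add s t in
     [/\ regular_op st, selfadjoint_op st & fredholm_op st]).
Proof.
split=> [t tr tf|_ _ t s tr tS sr sS tf tsc /=].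
  have [tc td _ _] := tr.
  have [[G [T [GT Tc]]] [G' [T' [GT' Tc']]]] :=
    (fredholm_parametrix tc td).1 tf.
  have [M1 M10 h1] := adjOp_bound G; have [M2 M20 h2] := adjOp_bound T.
  have [M3 M30 h3] := adjOp_bound G'; have [M4 M40 h4] := adjOp_bound T'.
  pose M := M1 + M2 + M3 + M4; have M0 : 0 <= M by rewrite /M; lra.
  have le_M (a : R) x : 0 <= a -> 0 <= M - a -> a * nrm x <= M * nrm x.
    by move=> a0 aM; rewrite ler_wpM2r ?nrm_ge0// -subr_ge0.
  have den0 : 0 < 32 * (1 + M) by lra.
  (* Then [e] and [e M] are at most [1/32]: enough for the bound [1/16] of [regular_add_bounded],
     for [e M] and [2 e M] below [1/8], and for [4 e] below [1/2] in the selfadjoint case. *)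
  pose e := (32 * (1 + M))^-1; have e0 : 0 < e by rewrite invr_gt0.
  have eM : e * (1 + M) = 32^-1 by rewrite /e; field; lra.
  have eM0 : 0 <= e * M by rewrite mulr_ge0// ltW.
  have GTM x : nrm (G x) + nrm (T x) <= M * nrm x.
    apply: (@le_trans _ _ ((M1 + M2) * nrm x)).
      by rewrite mulrDl lerD.
    by apply: le_M; rewrite /M; lra.
  have GTM' x : nrm (G' x) + nrm (T' x) <= M * nrm x.
    apply: (@le_trans _ _ ((M3 + M4) * nrm x)).
      by rewrite mulrDl lerD.
    by apply: le_M; rewrite /M; lra.
  exists e; split=> //.
  - move=> D DS De Dt; have Db x : nrm (D x) <= e * nrm x.
      rewrite (le_trans (adjOp_opnorm D x))//.
      by rewrite ler_wpM2r ?nrm_ge0.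
    have Dtr : regular_op Dt.
      by apply: (regular_add_bounded tr DS Db (ltW e0)); lra.
    split=> //.
    apply: (fredholm_add_bounded Dtr DS Db GT Tc GT' Tc' _ _ M0 (ltW e0)).
    + by move=> x; have := GTM x; have := nrm_ge0 (T x); lra.
    + by move=> x; have := GTM' x; have := nrm_ge0 (T' x); lra.
    + by lra.
  - move=> tS s sr sS ds sb ts.
    have [[tSym _] [sSym _]] := (selfadjointP tS, selfadjointP sS).
    (* The term [e |s x|] hidden in [|t x + s x|] is at most half of [|s x|] and is absorbed on the
       left. *)
    have {}sb x : dom t x -> nrm (s x) <= 2 * e * (nrm (t x) + nrm x).
      move=> /sb; rewrite !hnorm_nrm => h.
      have h5 := ler_wpM2l (ltW e0) (nrmD (t x) (s x)).
      have h6 := nrm_ge0 (s x).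
      have : e * nrm (s x) <= 2^-1 * nrm (s x) by rewrite ler_wpM2r//; lra.
      by lra.
    have [tsr tss] : regular_op ts /\ selfadjoint_op ts.
      apply: (@selfadjoint_add_small _ _ _ _ _ 2^-1) => //; [lra..|].
      (* The relative bound is already small at [|mu| = 1], so no rescaling is required. *)
      exists 0%N => mu x; rewrite expr0 => mu1 dx.
      have [b1 b2] := ishift_bound mu tSym dx; rewrite mu1 mul1r in b2.
      apply: (le_trans (sb x dx)).
      apply: (@le_trans _ _ (2 * e * (2 * nrm (ishift t mu x)))).
        by rewrite ler_wpM2l//; lra.
      by rewrite mulrA ler_wpM2r ?nrm_ge0//; lra.
    split=> //; have [_ sd _ _] := sr.
    apply: (@selfadjoint_add_fredholm _ _ _ _ _ G T (2 * e * M)) => //.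
    + by lra.
    + move=> x; have /graphP[dG tG] := GT x.
      have e20 : 0 <= 2 * e by lra.
      have := ler_wpM2l e20 (GTM x); have := sb _ dG; rewrite tG; lra.
    + by left; lra.
  - move=> s sr gse; have [sc sd _ _] := sr.
    apply/fredholm_parametrix => //; split.
      by apply: (right_parametrix_gap tr sr GT Tc GTM M0 (ltW e0)) => //; lra.
    apply: (adjoint_parametrix_gap tr sr GT' Tc' GTM' M0 (ltW e0)) => //; lra.
rewrite unbOp_addC; set ts := unbOp_add t s.
have [[tSym _] [sSym _]] := (selfadjointP tS, selfadjointP sS).
have [_ td _ _] := tr; have [_ sd _ _] := sr; have [ds _] := tsc.
have [G [T [GT Tc]]] := (selfadjoint_fredholm tr tS).1 tf.
have rb := relatively_compact_relbound tSym td tsc.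
have [tsr tss] : regular_op ts /\ selfadjoint_op ts.
  apply: (@selfadjoint_add_small _ _ _ _ _ 2^-1) => //; [lra..|].
  (* With relative bound [1/4] and [|mu| >= 4 C], both [|t x| / 4] and [C |x|] are at most a quarter
     of the norm of [(t + i mu) x]. *)
  have q0 : 0 < 4^-1 :> R by lra.
  have [C C0 sC] := rb _ q0; have [n nC] := exp_three_halves_ge (4 * C).
  exists n => mu x mun dx; have [b1 b2] := ishift_bound mu tSym dx.
  have := sC x dx; have : 4 * C * nrm x <= `|mu| * nrm x.
    by rewrite ler_wpM2r ?nrm_ge0// mun.
  by have := nrm_ge0 (ishift t mu x); lra.
have [M1 M10 h1] := adjOp_bound G; have [M2 M20 h2] := adjOp_bound T.
(* Any relative bound suffices here: it is used only to see that [s G] is bounded. *)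
have [C C0 sC] := rb 1 ltr01.
split=> //.
apply: (@selfadjoint_add_fredholm _ _ _ _ _ G T (M2 + C * M1)) => //.
- by rewrite addr_ge0 ?mulr_ge0// ltW.
- move=> x; have /graphP[dG tG] := GT x.
  have := sC _ dG; rewrite tG mul1r => h; have := ler_wpM2l C0 (h1 x).
  by have := h2 x; lra.
- by right; exact: relatively_compact_comp tsc GT.
Qed.
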